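(* Let $(\xi_i)_{i\in\mathbb{N}}$ be integer-valued i.i.d. random variables such that $\mathbb{E}|\xi_1|<\infty$ and $\mathbb{E}\exp\{\gamma\xi_1\}<\infty$ for all $\gamma>0$. Let $\omega:=\sup\{m\in\mathbb{Z}:\mathbb{P}(\xi_1=m)>0\}$ denote the upper bound of the distribution, and assume that one of the following two conditions holds: either (i) $\omega=\infty$, or (ii) $\omega<\infty$ and $\mathbb{P}(\xi_1=\omega)<1/2$. Let $\gamma_*,\rho_*,\sigma$ and $M_n$ be as defined in the context. Then, as $n\to\infty$, $$\mathbb{P}\left\{M_n<\rho_* n-\frac{\ln n}{2\gamma_*}+z\right\}=\exp\left\{-\,\frac{\exp\{-\gamma_* z\}\,(1+o(1))}{\sqrt{2\pi}\,\sigma(\gamma_* )\,(1-e^{-\gamma_*})}\right\},$$ uniformly over $z\in I\cap\left[\mathbb{Z}-\rho_* n+\frac{\ln n}{2\gamma_*}\right]$ for any bounded interval $I$; that is, uniformly over those $z\in I$ for which $\rho_* n-\frac{\ln n}{2\gamma_*}+z$ is an integer.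
   Context: Let $S_n:=\sum_{i=1}^n\xi_i$, let $S_n^{(j)}$, $1\le j\le 2^n$, be independent copies of $S_n$, and let $M_n:=\max_{1\le j\le 2^n}S_n^{(j)}$. The cumulant is $L(\gamma):=\ln\mathbb{E}\exp\{\gamma\xi_1\}$. The number $\gamma_*$ denotes the unique solution $\gamma\in(0,+\infty)$ of the equation $L(\gamma)-\gamma L'(\gamma)=\ln(1/2)$ (a solution exists and is unique under the stated moment assumptions together with (i) or (ii)). Further, $\rho_*:=L'(\gamma_* )$, and $\sigma(\gamma)>0$ is defined for $\gamma>0$ by $\sigma(\gamma)^2=L''(\gamma)$.
   Formalization: The law of ξ_1 is additionally assumed not to be concentrated on any a+hZ with h≥2 (maximal span 1); without this the claim is false, e.g. for ξ_1=±1 with probabilities 1/4, 3/4. *)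

(* Defs.v *)
From HB Require Import structures.
From mathcomp Require Import all_boot all_order all_algebra finmap.
From mathcomp Require Import all_classical all_reals all_analysis.
Set Implicit Arguments.
Unset Strict Implicit.
Unset Printing Implicit Defensive.
Import Order.TTheory GRing.Theory Num.Theory.
Import numFieldNormedType.Exports.
Local Open Scope classical_set_scope.
Local Open Scope ring_scope.

Section definitions.
Context d (T : measurableType d) (R : realType) (P : probability T R).

Definition independent_RVs (I : choiceType) (X : I -> {RV P >-> R}) : Prop :=
  forall (J : {fset I}) (B : I -> set R), (forall i, measurable (B i)) ->
    P (\bigcap_(i in [set` J]) (X i @^-1` B i)) =
    (\prod_(i <- J) P (X i @^-1` B i))%E.

(* Only measurable sets are compared: [distribution P X = distribution P Y]
   would also constrain the values of P on non-measurable sets. *)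
Definition same_law (X Y : T -> R) : Prop :=
  forall B : set R, measurable B -> P (X @^-1` B) = P (Y @^-1` B).

Definition iid (I : choiceType) (X : I -> {RV P >-> R}) : Prop :=
  independent_RVs X /\ forall i j, same_law (X i) (X j).

(* The sequence is indexed from 0: xi_1, ..., xi_n are xi 0, ..., xi n.-1. *)
Definition walk (xi : nat -> {RV P >-> R}) (n : nat) : T -> R :=
  fun w => \sum_(i < n) xi i w.

Definition independent_copies (I : choiceType) (Y : T -> R)
    (X : I -> {RV P >-> R}) : Prop :=
  independent_RVs X /\ forall i, same_law (X i) Y.

(* The index set is never empty, so the value is finite; -oo is only the
   neutral element of the maximum. *)
Definition max_copies (S : forall n : nat, 'I_(2 ^ n) -> {RV P >-> R})
    (n : nat) : T -> \bar R :=
  fun w => (\big[maxe/-oo]_(j < 2 ^ n) (S n j w)%:E)%E.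

Definition cumulant (X : {RV P >-> R}) : R -> R :=
  fun gamma => ln (fine ('M_P X gamma)).

(* Supremum in the extended reals, so that it is +oo when X is unbounded. *)
Definition upper_bound (X : {RV P >-> R}) : \bar R :=
  ereal_sup [set (m%:~R)%:E | m in
    [set m : int | (0 < P (X @^-1` [set m%:~R]))%E]].

(* X has maximal span 1: it is not almost surely confined to a coset a + hZ
   of a proper subgroup hZ of Z. *)
Definition maximal_span_one (X : {RV P >-> R}) : Prop :=
  forall (h : nat) (a : int), (1 < h)%N ->
    (P [set w | exists k : int, X w = (a + k * h%:Z)%:~R] < 1)%E.

Definition is_gamma_star (X : {RV P >-> R}) (gamma : R) : Prop :=
  0 < gamma /\
  cumulant X gamma - gamma * (cumulant X)^`()%classic gamma = ln 2^-1.

(* [get] picks a solution if there is one, and a default value otherwise. *)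
Definition gamma_star (X : {RV P >-> R}) : R := get (is_gamma_star X).

Definition rho_star (X : {RV P >-> R}) : R :=
  (cumulant X)^`()%classic (gamma_star X).

Definition sigma (X : {RV P >-> R}) (gamma : R) : R :=
  Num.sqrt ((cumulant X)^`(2)%classic gamma).

Definition level (X : {RV P >-> R}) (n : nat) (z : R) : R :=
  rho_star X * n%:R - ln n%:R / (2 * gamma_star X) + z.

End definitions.

(* Main.v *)
Require Import Defs.
From HB Require Import structures.
From mathcomp Require Import all_boot all_order all_algebra finmap.
From mathcomp Require Import all_classical all_reals all_analysis.
From mathcomp Require Import ring lra zify.
From mathcomp Require Import measurable_realfun.
Import Order.TTheory GRing.Theory Num.Theory.
Import numFieldNormedType.Exports.
Local Open Scope classical_set_scope.
Local Open Scope ring_scope.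

(** Write [phi g] for the moment generating function of a step, [gs] for
    gamma_star and [rho] for rho_star.  By independence
      [P (M_n < x) = (1 - P (S_n >= x)) ^+ (2 ^ n)]   ([max_copies_lt]),
    so, as [- ln (1 - p) = p + O(p ^ 2)], the theorem follows once
    [2 ^ n * expR (gs * z) * P (S_n >= x)] is known to converge to
    [(sqrt (2 * pi) * sigma * (1 - expR (- gs)))^-1], uniformly over the
    integers [x = n * rho - ln n / (2 * gs) + z] with [z] bounded
    ([tail_asymptotics], with error [O(n ^ (-1/4))]).

    That [gs] solves its equation at all is [gamma_star_spec]: the solutions
    are the critical points of [g |-> (ln (phi g) + ln 2) / g], a function
    which tends to +oo at 0 and which, under either hypothesis on the upper
    bound of the law, goes below some value that it exceeds at infinity; so
    it has an interior minimum.  The equation says precisely that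
    [2 * phi gs = expR (gs * rho)].  Hence the exponential weights cancel
    ([critical_scaling]): with
      [q_n k = expR (gs * k) * P (S_n = k) / phi gs ^+ n],
    the law of [S_n] after exponential tilting by [gs],
      [2 ^ n * expR (gs * z) * P (S_n = x + j)
         = expR (- gs) ^+ j * (sqrt n * q_n (x + j))].
    Under the tilted law a step has mean [rho] and variance [sigma ^+ 2].
    The local limit theorem with rate
      [sqrt n * q_n k = (sqrt (2 * pi) * sigma)^-1
                          + O((1 + |k - n * rho|) / sqrt n)]
    ([local_limit]) applies to each term, and the sum over [j < n] is a
    geometric series; the rest of the tail, beyond [x + n], is negligible by
    the Chernoff bound ([walk_tail_chernoff]).

    The local limit theorem is proved by Fourier inversion.  All transforms
    are kept under the untilted probability: the complex number
    [E (expR ((g + i * t) * X) * expR (- i * t * c))] is represented by its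
    real and imaginary parts, divided by [phi g] ([zcos], [zsin]); it is
    multiplicative along the walk ([walk_transform]), and integrating it over
    a period isolates one value of the walk ([fourier_inversion]).  The
    integral is compared with a Gaussian one in [fourier_laplace], from two
    properties of the characteristic function [Z] of a tilted centred step:
    its Taylor expansion at 0 with a cubic error ([transform_taylor]) and the
    bound [|Z t| ^+ 2 <= 1 - k * t ^+ 2] on the whole of [[0, pi]]
    ([transform_gap]).  The latter is where the maximal span enters: the
    integers [d] for which [1 - cos (t * d) = O(1 - |Z t| ^+ 2)] form a
    subgroup that contains all differences of atoms, so 1 is among them
    ([span_one_transform]). *)

(** * Trigonometric and exponential inequalities *)
Section elementary.
Context {R : realType}.
Implicit Types x y t : R.

Lemma derivable_continuous_at (f df : R -> R) :
  (forall x, is_derive x 1 f (df x)) -> continuous f.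
Proof.
move=> fd x; apply/differentiable_continuous/derivable1_diffP.
by have := fd x => /@ex_derive.
Qed.

Lemma sin_MVT x : 0 <= x -> exists2 c, 0 <= c <= x & sin x = cos c * x.
Proof.
move=> x0; have [|c] := @MVT_segment R sin cos 0 x x0 (fun y _ => is_derive_sin y).
  by apply: continuous_subspaceT => y; exact: continuous_sin.
by rewrite in_itv/= sin0 !subr0 => cx ->; exists c.
Qed.

Lemma sin_le x : 0 <= x -> sin x <= x.
Proof.
move=> x0; have [c _ ->] := sin_MVT x x0.
by rewrite ler_piMl// cos_le1.
Qed.

Lemma norm_sin_le x : `|sin x| <= `|x|.
Proof.
have H y : 0 <= y -> `|sin y| <= y.
  move=> y0; rewrite ler_norml sin_le// andbT.
  have [c _ ->] := sin_MVT y y0.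
  by rewrite -mulN1r ler_wpM2r// cos_geN1.
have [x0|x0] := leP 0 x; first by rewrite (ger0_norm x0); exact: H.
by rewrite -normrN -sinN (ltr0_norm x0) H// oppr_ge0 ltW.
Qed.

Lemma cos_le_decr x y : 0 <= x -> x <= y -> y <= pi -> cos y <= cos x.
Proof.
move=> x0 xy yp; have [->//|xy'] := eqVneq x y.
have xp := le_trans xy yp; have y0 := le_trans x0 xy.
by apply: ltW; rewrite ltr_cos ?in_itv/= ?x0 ?yp ?y0 ?xp// lt_neqAle xy' xy.
Qed.

Lemma mul_cos_le_sin x : 0 <= x -> x <= pi -> x * cos x <= sin x.
Proof.
move=> x0 xp; have [c /andP[c0 cx] ->] := sin_MVT x x0.
by rewrite mulrC ler_wpM2r// cos_le_decr.
Qed.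

Lemma cos_half x : cos x = 1 - 2 * sin (x / 2) ^+ 2.
Proof.
rewrite {1}(_ : x = (x / 2) *+ 2); last by rewrite -mulr_natr divfK.
by rewrite cos_mulr2n cos2sin2; ring.
Qed.

Lemma sin_half x : sin x = 2 * (cos (x / 2) * sin (x / 2)).
Proof.
rewrite {1}(_ : x = (x / 2) *+ 2); last by rewrite -mulr_natr divfK.
by rewrite sin_mulr2n mulr_natl.
Qed.

Lemma one_sub_cos_ge0 x : 0 <= 1 - cos x.
Proof. by rewrite subr_ge0 cos_le1. Qed.

Lemma one_sub_cos_le x : 1 - cos x <= x ^+ 2 / 2.
Proof.
rewrite cos_half opprB addrC subrK.
have : sin (x / 2) ^+ 2 <= (x / 2) ^+ 2.
  by rewrite -real_normK ?num_real// -[leRHS]real_normK ?num_real// lerXn2r ?nnegrE// norm_sin_le.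
by rewrite exprMn; lra.
Qed.

Lemma one_sub_cos_le_norm x : 1 - cos x <= `|x|.
Proof.
have [x2|x2] := leP `|x| 2; last first.
  by have := cos_geN1 x; lra.
apply: (le_trans (one_sub_cos_le x)).
have h : 0 <= `|x| * (2 - `|x|) by rewrite mulr_ge0 ?subr_ge0.
by rewrite -real_normK ?num_real// expr2; lra.
Qed.

(** With [y = x / 2], [sin x = 2 * cos y * sin y >= x * cos y ^+ 2], and
    [cos y ^+ 2 >= 1 / 2] as long as [cos x >= 0]. *)
Lemma sin_ge_half x : 0 <= x -> x <= pi / 2 -> x / 2 <= sin x.
Proof.
move=> x0 xp; have p0 := pi_gt0 R.
rewrite sin_half; have := mul_cos_le_sin (x / 2) ltac:(lra) ltac:(lra).
have c0 : 0 <= cos (x / 2) by apply: cos_ge0_pihalf; lra.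
have cx : 0 <= cos x by apply: cos_ge0_pihalf; lra.
move: cx; rewrite cos_half => cx; have cs := cos2sin2 (x / 2) => h.
have := ler_wpM2l c0 h; rewrite mulrCA -expr2 cs => h2.
have : 0 <= x * (2^-1 - sin (x / 2) ^+ 2) by rewrite mulr_ge0//; lra.
by lra.
Qed.

(** On [[0, pi]] from [x * cos x <= sin x] and [1 - cos x <= x ^+ 2 / 2];
    beyond [pi] the cube is so large that [|sin| <= 1] suffices. *)
Lemma sin_sub_le x : `|sin x - x| <= `|x| ^+ 3.
Proof.
have H y : 0 <= y -> `|sin y - y| <= y ^+ 3.
  move=> y0; rewrite ler_norml; apply/andP; split; last first.
    have := sin_le y y0; have : 0 <= y ^+ 3 by rewrite exprn_ge0.
    by lra.
  have p2 := pi_ge2 R.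
  have [yp|yp] := leP y pi.
    have h := mul_cos_le_sin y y0 yp; have := ler_wpM2l y0 (one_sub_cos_le y).
    have : 0 <= y ^+ 3 by rewrite exprn_ge0.
    by rewrite !exprS expr0; lra.
  have := sin_geN1 y.
  have : 2 * (2 * y) <= y ^+ 3.
    by rewrite !exprS expr0 mulr1 !ler_pM// ?mulr_ge0//; lra.
  by lra.
have [x0|x0] := leP 0 x; first by rewrite (ger0_norm x0); exact: H.
have := H (- x); rewrite sinN -opprD normrN (ltr0_norm x0); apply; lra.
Qed.

(** With [h = x / 2], the difference is [2 * (h ^+ 2 - sin h ^+ 2)].  Its
    factor [h - sin h] has to be quadratically small for every [h]: this holds
    by the cubic bound when [|h| <= 1] and by the linear one otherwise. *)
Lemma cos_sub_le x : `|cos x - (1 - x ^+ 2 / 2)| <= `|x| ^+ 3.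
Proof.
have [h xh] : exists h, x = 2 * h by exists (x / 2); field.
have -> : cos x - (1 - x ^+ 2 / 2) = 2 * ((h - sin h) * (h + sin h)).
  by rewrite cos_half xh (_ : 2 * h / 2 = h); field.
have h1 := norm_sin_le h.
have h2 : `|h + sin h| <= 2 * `|h| by apply: (le_trans (ler_normD _ _)); lra.
have h3 : `|h - sin h| <= 2 * `|h| by apply: (le_trans (ler_normB _ _)); lra.
have h4 := sin_sub_le h; rewrite distrC in h4.
have h5 : `|h - sin h| <= 2 * `|h| ^+ 2.
  have [h1'|h1'] := leP `|h| 1.
    apply: (le_trans h4); rewrite !exprS expr0 !mulr1.
    have a0 := normr_ge0 h; have : 0 <= `|h| * `|h| * (1 - `|h|) by rewrite !mulr_ge0// subr_ge0.
    by have := mulr_ge0 a0 a0; lra.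
  apply: (le_trans h3); rewrite expr2 ler_pM2l// ler_peMr//; exact: ltW.
have -> : `|x| = 2 * `|h|.
  by rewrite xh normrM ger0_norm.
rewrite !normrM (ger0_norm (ler0n R 2)).
have := normr_ge0 h; have := normr_ge0 (h - sin h); have := normr_ge0 (h + sin h).
move: h2 h5; set a := `|h|; set b := `|h - _|; set c := `|h + _| => h2 h5 c0 b0 a0.
rewrite (_ : (2 * a) ^+ 3 = 2 * (2 * a ^+ 2 * (2 * a))); last by ring.
by rewrite ler_pM2l// ler_pM.
Qed.

(** From [expR (- x) * (1 + x) <= expR (- x) * expR x = 1]. *)
Lemma expRN_sub_le x : 0 <= x -> `|expR (- x) - (1 - x)| <= x ^+ 2.
Proof.
move=> x0; have h := expR_ge1Dx (- x).
rewrite ger0_norm; last by lra.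
have h2 : expR (- x) * (1 + x) <= 1.
  rewrite -[leRHS](@expRxMexpNx_1 R x) mulrC ler_wpM2r ?expR_ge0// expR_ge1Dx//.
have h3 := expR_gt0 (- x).
have : 0 <= x * (x - x * expR (- x)).
  have : 0 <= x ^+ 2 * (1 - expR (- x)) by rewrite mulr_ge0 ?sqr_ge0// subr_ge0 -expR0 ler_expR; lra.
  by rewrite expr2; lra.
have : 0 <= x * expR (- x) by rewrite mulr_ge0.
have : 0 <= x * (expR (- x) - (1 - x)) by rewrite mulr_ge0//; lra.
rewrite expr2; lra.
Qed.

(** Since [1 - cos x] is half the squared distance of [expR (i * x)] to 1, this
    is the parallelogram bound [|u + v| ^+ 2 <= 2 |u| ^+ 2 + 2 |v| ^+ 2]. *)
Lemma one_sub_cosD x y :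
  1 - cos (x + y) <= 2 * (1 - cos x) + 2 * (1 - cos y).
Proof.
rewrite cosD.
have hx := cos2Dsin2 x; have hy := cos2Dsin2 y.
move: hx hy.
set a := cos x; set b := sin x; set c := cos y; set d := sin y => *.
have : 0 <= (b - d) ^+ 2 by exact: sqr_ge0.
have : 0 <= (a + c - 2) ^+ 2 by exact: sqr_ge0.
lra.
Qed.

Lemma one_sub_cos_ge x : 0 <= x -> x <= pi -> x ^+ 2 / 8 <= 1 - cos x.
Proof.
move=> x0 xp; rewrite cos_half opprB addrC subrK.
have h := sin_ge_half (x / 2) ltac:(lra) ltac:(lra).
have : (x / 2 / 2) * (x / 2 / 2) <= sin (x / 2) * sin (x / 2).
  by rewrite ler_pM//; lra.
by rewrite expr2; lra.
Qed.

End elementary.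

(** * Powers of complex numbers *)
Section complex_powers.
Context {R : realType}.
Implicit Types a b g M : R.

(** Real and imaginary parts of [(a + i * b) ^+ n]; a pair of reals keeps all
    integrals real-valued. *)
Fixpoint cpow a b (n : nat) : R * R :=
  if n is m.+1 then
    ((cpow a b m).1 * a - (cpow a b m).2 * b,
     (cpow a b m).1 * b + (cpow a b m).2 * a)
  else (1, 0).

Lemma cpow_norm a b n :
  (cpow a b n).1 ^+ 2 + (cpow a b n).2 ^+ 2 = (a ^+ 2 + b ^+ 2) ^+ n.
Proof.
elim: n => [|n IH] /=; first by rewrite expr1n expr0n addr0 expr0.
rewrite [RHS]exprS -IH; ring.
Qed.

Lemma cpowZ k a b n :
  cpow (k * a) (k * b) n = (k ^+ n * (cpow a b n).1, k ^+ n * (cpow a b n).2).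
Proof.
elim: n => [|n IH] /=; first by rewrite expr0 mul1r mulr0.
by rewrite IH /= exprS; congr pair; ring.
Qed.

Lemma cpow0 a n : (cpow a 0 n).1 = a ^+ n.
Proof.
by elim: n => [|n IH] //=; rewrite !mulr0 subr0 IH exprSr.
Qed.

Lemma cpow_le a b M n : 0 <= M -> a ^+ 2 + b ^+ 2 <= M ^+ 2 ->
  `|(cpow a b n).1| <= M ^+ n /\ `|(cpow a b n).2| <= M ^+ n.
Proof.
move=> M0 abM.
have H : (cpow a b n).1 ^+ 2 + (cpow a b n).2 ^+ 2 <= (M ^+ n) ^+ 2.
  by rewrite cpow_norm exprAC lerXn2r// nnegrE ?addr_ge0 ?sqr_ge0.
have Mn : 0 <= M ^+ n by rewrite exprn_ge0.
split; rewrite -[leRHS]ger0_norm// -ler_sqr ?nnegrE// !real_normK ?num_real//.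
- by apply: le_trans H; rewrite lerDl sqr_ge0.
- by apply: le_trans H; rewrite lerDr sqr_ge0.
Qed.

(** Telescoping with [Z = a + i * b]:
    [Z ^+ n.+1 - g ^+ n.+1 = g * (Z ^+ n - g ^+ n) + Z ^+ n * (Z - g)], where
    both [|Z|] and [g] are at most [M]. *)
Lemma cpow_sub a b g M n : 0 <= g -> g <= M -> a ^+ 2 + b ^+ 2 <= M ^+ 2 ->
  `|(cpow a b n.+1).1 - g ^+ n.+1| <= n.+1%:R * M ^+ n * (`|a - g| + `|b|) /\
  `|(cpow a b n.+1).2| <= n.+1%:R * M ^+ n * (`|a - g| + `|b|).
Proof.
move=> g0 gM abM; have M0 := le_trans g0 gM.
set e := `|a - g| + `|b|.
have e0 : 0 <= e by rewrite addr_ge0.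
have step m (x y : R) : `|x| <= M ^+ m -> `|y| <= M ^+ m ->
    `|x| * `|a - g| + `|y| * `|b| <= M ^+ m * e /\
    `|x| * `|b| + `|y| * `|a - g| <= M ^+ m * e.
  by move=> xM yM; split; rewrite /e mulrDr; [|rewrite [leRHS]addrC];
    apply: lerD; apply: ler_wpM2r.
elim: n => [|n [IH1 IH2]].
  have [h1 h2] := step 0 1 0 ltac:(by rewrite normr1) ltac:(by rewrite normr0).
  rewrite normr1 normr0 !mul0r !addr0 !mul1r in h1 h2.
  by rewrite /= !mul1r !mul0r subr0 addr0 !expr1.
set x := (cpow a b n.+1).1 in IH1 *; set y := (cpow a b n.+1).2 in IH2 *.
have [hx hy] := cpow_le a b M n.+1 M0 abM.
have [h1 h2] := step n.+1 x y hx hy.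
have -> : (cpow a b n.+2).1 - g ^+ n.+2 =
   g * (x - g ^+ n.+1) + (x * (a - g) - y * b).
  by rewrite [(cpow a b n.+2).1](_ : _ = x * a - y * b)// (exprS g n.+1); ring.
have -> : (cpow a b n.+2).2 = g * y + (x * b + y * (a - g)).
  by rewrite [(cpow a b n.+2).2](_ : _ = x * b + y * a)//; ring.
have E : n.+2%:R * M ^+ n.+1 * e = M * (n.+1%:R * M ^+ n * e) + M ^+ n.+1 * e.
  by rewrite -[in LHS]natr1 exprS; ring.
rewrite E; split; apply: (le_trans (ler_normD _ _)); apply: lerD.
- by rewrite normrM (ger0_norm g0) ler_pM.
- by apply: (le_trans (ler_normB _ _)); rewrite !normrM.
- by rewrite normrM (ger0_norm g0) ler_pM.
- by apply: (le_trans (ler_normD _ _)); rewrite !normrM.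
Qed.

End complex_powers.

(** * The walk and its next step *)
Section independence.
Context {R : realType} {d : measure_display} {T : measurableType d}
  {P : probability T R}.

Lemma measurable_walk (xi : nat -> {RV P >-> R}) n :
  measurable_fun setT (walk xi n).
Proof. by apply: measurable_sum => i. Qed.

(** Here [G] is meant to be the class of cylinder sets over the first [n]
    steps. *)
Lemma measurable_walk_past (xi : nat -> {RV P >-> R}) n
    (G : set (set T)) :
  (forall i B, (i < n)%N -> measurable B -> G (xi i @^-1` B)) ->
  measurable_fun (setT : set (g_sigma_algebraType G)) (walk xi n : g_sigma_algebraType G -> R).
Proof.
move=> HG; apply: measurable_sum => i _ B mB; rewrite setTI.
by apply: sub_sigma_algebra; apply: HG.
Qed.

(** Joint independence only gives the product rule on cylinder sets.  These
    form a pi-system that generates every event of the first [n] steps, and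
    two finite measures that agree on it agree on all such events. *)
Lemma independent_walk (xi : nat -> {RV P >-> R}) n (A B : set R) :
  independent_RVs xi -> measurable A -> measurable B ->
  P (walk xi n @^-1` A `&` xi n @^-1` B) =
  (P (walk xi n @^-1` A) * P (xi n @^-1` B))%E.
Proof.
move=> ind mA mB.
pose J : {fset nat} := [fset i in iota 0 n]%fset.
have inJ i : (i \in J) = (i < n)%N by rewrite inE mem_iota.
pose cyl (C : nat -> set R) := \bigcap_(i in [set` J]) (xi i @^-1` C i).
pose G : set (set T) :=
  [set X | exists2 C : nat -> set R, (forall i, measurable (C i)) & X = cyl C].
have mcyl C : (forall i, measurable (C i)) -> measurable (cyl C).
  move=> mC; apply: fin_bigcap_measurable => // i _.
  by rewrite -[X in measurable X]setTI; exact: measurable_funP.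
have GT : G setT.
  exists (fun=> setT) => //; apply/esym/seteqP; split => // w _ i _.
have GI : setI_closed G.
  move=> _ _ [C mC ->] [D mD ->]; exists (fun i => C i `&` D i).
    by move=> i; exact: measurableI.
  apply/seteqP; split => w; rewrite /cyl /bigcap/=.
    by move=> [h1 h2] i iJ; split; [exact: h1|exact: h2].
  by move=> h; split => i iJ; have [] := h i iJ.
have mF : measurable (xi n @^-1` B).
  by rewrite -[X in measurable X]setTI; exact: measurable_funP.
have Ffin : P (xi n @^-1` B) \is a fin_num by exact: fin_num_measure.
pose k : {nonneg R} := NngNum (fine_ge0 (measure_ge0 P (xi n @^-1` B))).
have Ek X : mscale k P X = (P X * P (xi n @^-1` B))%E.
  by rewrite muleC -[in RHS](fineK Ffin).
have Gm : G `<=` measurable by move=> _ [C mC ->]; exact: mcyl.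
(* Uniqueness of finite measures on the sigma-algebra generated by [G]. *)
have E : forall X, <<s G >> X -> mrestr P mF X = mscale k P X.
  apply: (g_sigma_algebra_measure_unique G Gm (fun=> setT)) => //.
  - by apply/seteqP; split => // w _; exists 0%N.
  - move=> _ [C mC ->]; rewrite [RHS]Ek -[LHS]/(P (cyl C `&` (xi n @^-1` B))).
    pose D i := if i == n then B else C i.
    have mD i : measurable (D i) by rewrite /D; case: ifP.
    have nJ : n \notin J by rewrite inJ ltnn.
    have -> : cyl C = cyl D.
      apply: eq_bigcapr => i; rewrite /= inJ /D.
      by case: eqP => // -> /[!ltnn].
    rewrite /cyl (ind J D mD).
    rewrite [X in (_ * P (_ @^-1` X))%E](_ : B = D n); last by rewrite /D eqxx.
    rewrite muleC -(big_fsetU1 _ (fun i => P (xi i @^-1` D i)) nJ) -ind//; congr (P _).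
    apply/seteqP; split => w /=.
      move=> [h1 h2] i /=; rewrite in_fset1U => /orP[/eqP ->|]; last exact: h1.
      by rewrite /D eqxx.
    move=> h; split => [i iJ|]; first by apply: h; rewrite /= in_fset1U iJ orbT.
    by have := h n; rewrite /= in_fset1U eqxx /D eqxx; apply.
  - by move=> _; rewrite -[ltLHS]/(P (setT `&` xi n @^-1` B)) setTI ltey_eq Ffin.
have mW : <<s G >> (walk xi n @^-1` A).
  have HG i C : (i < n)%N -> measurable C -> G (xi i @^-1` C).
    move=> ltin mC; exists (fun j => if j == i then C else setT).
      by move=> j; case: ifP.
    apply/seteqP; split => w /=.
      by move=> Cw j _ /=; case: eqP => // ->.
    by move=> /(_ i); rewrite /= inJ eqxx; apply.
  by have := measurable_walk_past xi n G HG measurableT A mA; rewrite setTI.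
by rewrite -[LHS]/(mrestr P mF _) E//; exact: Ek.
Qed.

(** The product rule says that the joint law of [X] and [Y] is the product of
    their laws, so the statement is Fubini's theorem. *)
Lemma expectation_indepM (X Y : {RV P >-> R}) (f g : R -> R) :
  (forall A B, measurable A -> measurable B ->
    P (X @^-1` A `&` Y @^-1` B) = (P (X @^-1` A) * P (Y @^-1` B))%E) ->
  measurable_fun setT f -> measurable_fun setT g ->
  P.-integrable setT (EFin \o (f \o X)) -> P.-integrable setT (EFin \o (g \o Y)) ->
  P.-integrable setT (EFin \o (fun w => f (X w) * g (Y w))) /\
  \int[P]_w (f (X w) * g (Y w)) = \int[P]_w f (X w) * \int[P]_w g (Y w).
Proof.
move=> ind mf mg fi gi.
pose phi w := (X w, Y w).
have mphi : measurable_fun setT phi by exact/measurable_fun_pair.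
pose phiM := isMeasurableFun.Build _ _ _ _ _ mphi.
pose Phi : {mfun T >-> (R * R)%type} := HB.pack phi phiM.
have E U : measurable U -> (distribution P X \x distribution P Y)%E U = distribution P Phi U.
  apply: product_measure_unique => A B mA mB.
  by rewrite /= /distribution /= /pushforward -ind.
pose h0 (z : R * R) := f z.1 * g z.2.
pose h : R * R -> \bar R := EFin \o h0.
have mh : measurable_fun setT (EFin \o h0).
  apply/measurable_EFinP; apply: measurable_funM; exact: measurableT_comp.
have mf' : measurable_fun setT (EFin \o f) by exact/measurable_EFinP.
have mg' : measurable_fun setT (EFin \o g) by exact/measurable_EFinP.
have maf : measurable_fun setT (abse \o (EFin \o f)) by exact: measurableT_comp.
have mag : measurable_fun setT (abse \o (EFin \o g)) by exact: measurableT_comp.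
have f0 x : setT x -> (0 <= (abse \o (EFin \o f)) x)%E by move=> _; exact: abse_ge0.
have g0 x : setT x -> (0 <= (abse \o (EFin \o g)) x)%E by move=> _; exact: abse_ge0.
have fin_f : (\int[P]_w `|(f (X w))%:E|)%E \is a fin_num.
  by rewrite ge0_fin_numE ?integral_ge0//; case/integrableP: fi.
have Ei : (\int[distribution P X]_x \int[distribution P Y]_y `|h (x, y)|)%E =
          (\int[P]_w `|(f (X w))%:E| * \int[P]_w `|(g (Y w))%:E|)%E.
  have Eh x y : (`|h (x, y)| = `|(f x)%:E| * `|(g y)%:E|)%E by rewrite -abseM.
  transitivity (\int[distribution P X]_x ((abse \o (EFin \o f)) x * \int[P]_w `|(g (Y w))%:E|))%E.
    apply: eq_integral => x _; under eq_integral => y _ do rewrite Eh.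
    etransitivity; first exact: (ge0_integralZl _ measurableT mag g0 (abse_ge0 _)).
    by congr (_ * _)%E; exact: (ge0_integral_distribution Y mag (fun y => abse_ge0 _)).
  etransitivity; first exact: (ge0_integralZr _ measurableT maf f0 (integral_ge0 _ (fun w _ => abse_ge0 _))).
  by congr (_ * _)%E; exact: (ge0_integral_distribution X maf (fun y => abse_ge0 _)).
have h1 : (distribution P X \x distribution P Y)%E.-integrable setT h.
  apply/integrable12ltyP => //=.
  rewrite Ei; apply: lte_mul_pinfty => //; first exact: integral_ge0.
  by case/integrableP: gi.
have mah : measurable_fun setT (abse \o (EFin \o h0)) by exact: measurableT_comp.
have EP (k : R * R -> \bar R) :
    (\int[distribution P Phi]_z k z = \int[distribution P X \x distribution P Y]_z k z)%E.
  by apply: eq_measure_integral => U mU _; exact/esym/E.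
have h2 : P.-integrable setT (h \o phi).
  apply/integrableP; split; first exact: (measurableT_comp mh).
  have -> : (\int[P]_w `|(h \o phi) w| =
      \int[distribution P X \x distribution P Y]_z `|h z|)%E.
    exact: etrans (esym (ge0_integral_distribution Phi mah (fun z => abse_ge0 _))) (EP _).
  by case/integrableP: h1.
split=> //.
have -> : \int[P]_w (f (X w) * g (Y w)) =
    fine (\int[distribution P X]_x \int[distribution P Y]_y h (x, y))%E.
  congr fine; rewrite integral12_prod_meas1//.
  exact: etrans (esym (integral_distribution (X := Phi) mh h2)) (EP h).
have Eg : (\int[P]_w (g (Y w))%:E)%E = (\int[P]_w g (Y w))%:E.
  by rewrite fineK//; exact: integrable_fin_num.
have fX : (distribution P X).-integrable setT (EFin \o f).
  exact: (@integrable_pushforward _ _ _ _ _ X).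
have gY : (distribution P Y).-integrable setT (EFin \o g).
  exact: (@integrable_pushforward _ _ _ _ _ Y).
transitivity (fine (\int[distribution P X]_x ((EFin \o f) x * (\int[P]_w g (Y w))%:E)))%E.
  congr fine; apply: eq_integral => x _.
  etransitivity; first exact: (integralZl measurableT gY (f x)).
  by congr (_ * _)%E; rewrite -Eg; exact: (integral_distribution mg' gi).
rewrite (integralZr measurableT fX).
have -> : (\int[distribution P X]_x (EFin \o f) x)%E = (\int[P]_w f (X w))%:E.
  rewrite fineK; last exact: integrable_fin_num.
  exact: (integral_distribution mf' fi).
by [].
Qed.

End independence.

(** * Multiplicativity of the transform *)
Section walk_transform.
Context {R : realType} {d : measure_display} {T : measurableType d}
  {P : probability T R}.

Lemma integrable_dominated (f g : T -> R) :
  measurable_fun setT f -> (forall w, `|f w| <= g w) ->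
  P.-integrable setT (EFin \o g) -> P.-integrable setT (EFin \o f).
Proof.
move=> mf fg; apply: le_integrable => //; first exact/measurable_EFinP.
move=> w _; rewrite /= lee_fin; exact: le_trans (fg w) (ler_norm _).
Qed.

Lemma integral_same_law (X Y : {RV P >-> R}) (f : R -> R) :
  same_law P X Y -> measurable_fun setT f ->
  P.-integrable setT (EFin \o (f \o X)) ->
  P.-integrable setT (EFin \o (f \o Y)) /\
  \int[P]_w f (Y w) = \int[P]_w f (X w).
Proof.
move=> XY mf fX.
have mf' : measurable_fun setT (EFin \o f) by exact/measurable_EFinP.
have maf : measurable_fun setT (abse \o (EFin \o f)) by exact: measurableT_comp.
have E (k : R -> \bar R) :
    (\int[distribution P Y]_z k z = \int[distribution P X]_z k z)%E.
  by apply: eq_measure_integral => U mU _; exact/esym/XY.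
have fY : P.-integrable setT (EFin \o (f \o Y)).
  apply/integrableP; split; first exact: (measurableT_comp mf').
  have -> : (\int[P]_w `|(EFin \o (f \o Y)) w| = \int[P]_w `|(EFin \o (f \o X)) w|)%E.
    etransitivity; first exact: esym (ge0_integral_distribution Y maf (fun z => abse_ge0 _)).
    by etransitivity; [exact: E|exact: (ge0_integral_distribution X maf (fun z => abse_ge0 _))].
  by case/integrableP: fX.
split=> //; congr fine.
etransitivity; first exact: esym (integral_distribution (X := Y) mf' fY).
by etransitivity; [exact: E|exact: (integral_distribution (X := X) mf' fX)].
Qed.

(** The real and imaginary parts of [expR ((g + i * t) * x - i * t * c)].  The
    centring [c] is built in because the Taylor expansion at [t = 0] is needed
    around the tilted mean. *)
Definition tcos (g t c x : R) : R := expR (g * x) * cos (t * (x - c)).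
Definition tsin (g t c x : R) : R := expR (g * x) * sin (t * (x - c)).

Lemma measurable_expZ (g : R) : measurable_fun setT (fun x : R => expR (g * x)).
Proof. apply: measurableT_comp => //; exact: measurable_funM. Qed.

Lemma measurable_phase (t c : R) : measurable_fun setT (fun x : R => t * (x - c)).
Proof. by apply: measurable_funM => //; exact: measurable_funB. Qed.

Lemma measurable_tcos g t c : measurable_fun setT (tcos g t c).
Proof.
apply: measurable_funM; first exact: measurable_expZ.
apply: measurableT_comp (measurable_phase t c).
by apply: continuous_measurable_fun => x; exact: continuous_cos.
Qed.

Lemma measurable_tsin g t c : measurable_fun setT (tsin g t c).
Proof.
apply: measurable_funM; first exact: measurable_expZ.
apply: measurableT_comp (measurable_phase t c).
by apply: continuous_measurable_fun => x; exact: continuous_sin.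
Qed.

Lemma tcos_le g t c x : `|tcos g t c x| <= expR (g * x).
Proof. by rewrite normrM ger0_norm ?expR_ge0// ler_piMr ?expR_ge0// cos_max. Qed.

Lemma tsin_le g t c x : `|tsin g t c x| <= expR (g * x).
Proof. by rewrite normrM ger0_norm ?expR_ge0// ler_piMr ?expR_ge0// sin_max. Qed.

Lemma tcosD g t c c' x y :
  tcos g t (c + c') (x + y) = tcos g t c x * tcos g t c' y - tsin g t c x * tsin g t c' y.
Proof.
rewrite /tcos /tsin (_ : t * _ = t * (x - c) + t * (y - c')); last by ring.
by rewrite cosD (mulrDr g) expRD; ring.
Qed.

Lemma tsinD g t c c' x y :
  tsin g t (c + c') (x + y) = tcos g t c x * tsin g t c' y + tsin g t c x * tcos g t c' y.
Proof.
rewrite /tcos /tsin (_ : t * _ = t * (x - c) + t * (y - c')); last by ring.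
by rewrite sinD (mulrDr g) expRD; ring.
Qed.

Lemma integrable_tcos (X : T -> R) g t c : measurable_fun setT X ->
  P.-integrable setT (EFin \o (fun w => expR (g * X w))) ->
  P.-integrable setT (EFin \o (tcos g t c \o X)).
Proof.
move=> mX; apply: integrable_dominated => [|w]; last exact: tcos_le.
exact: measurableT_comp (measurable_tcos g t c) mX.
Qed.

Lemma integrable_tsin (X : T -> R) g t c : measurable_fun setT X ->
  P.-integrable setT (EFin \o (fun w => expR (g * X w))) ->
  P.-integrable setT (EFin \o (tsin g t c \o X)).
Proof.
move=> mX; apply: integrable_dominated => [|w]; last exact: tsin_le.
exact: measurableT_comp (measurable_tsin g t c) mX.
Qed.

Lemma walkS (xi : nat -> {RV P >-> R}) n w : walk xi n.+1 w = walk xi n w + xi n w.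
Proof. by rewrite /walk big_ord_recr. Qed.

(** The expectation of [expR ((g + i * t) * (S_n - n * c))], up to the real
    factor [expR (g * n * c)], is the [n]-th power of that of one step;
    integrability has to be carried along the induction. *)
Lemma walk_transform (xi : nat -> {RV P >-> R}) g t c n : iid xi ->
  P.-integrable setT (EFin \o (fun w => expR (g * xi 0%N w))) ->
  P.-integrable setT (EFin \o (fun w => expR (g * walk xi n w))) /\
  (\int[P]_w tcos g t (n%:R * c) (walk xi n w),
   \int[P]_w tsin g t (n%:R * c) (walk xi n w)) =
  cpow (\int[P]_w tcos g t c (xi 0%N w)) (\int[P]_w tsin g t c (xi 0%N w)) n.
Proof.
move=> [ind id] int0.
have intn m f := integral_same_law (xi 0%N) (xi m) f (id 0%N m).
elim: n => [|n [IH1 IH2]].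
  have E w : walk xi 0 w = 0 by rewrite /walk big_ord0.
  split.
    apply: (@integrable_dominated _ (cst 1)).
    - exact: measurableT_comp (measurable_expZ g) (measurable_walk xi 0).
    - by move=> w; rewrite E mulr0 expR0 normr1.
    - exact: finite_measure_integrable_cst.
  have PT : fine (P setT) = 1 by rewrite probability_setT.
  rewrite /= mul0r; congr pair.
    under eq_Rintegral => w _ do rewrite E /tcos subrr !mulr0 expR0 cos0 mulr1.
    by rewrite Rintegral_cst// PT mulr1.
  under eq_Rintegral => w _ do rewrite E /tsin subrr !mulr0 expR0 sin0 mulr0.
  by rewrite Rintegral_cst// mul0r.
have mW := measurable_walk xi n.
pose W : {RV P >-> R} := HB.pack (walk xi n) (isMeasurableFun.Build _ _ _ _ _ mW).
have indW A B : measurable A -> measurable B ->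
    P (W @^-1` A `&` xi n @^-1` B) = (P (W @^-1` A) * P (xi n @^-1` B))%E.
  exact: independent_walk.
have mxi m : measurable_fun setT (xi m) by [].
have [eX _] := intn n _ (measurable_expZ g) int0.
have [_ cX] := intn n _ (measurable_tcos g t c) (integrable_tcos _ _ _ _ (mxi 0%N) int0).
have [_ sX] := intn n _ (measurable_tsin g t c) (integrable_tsin _ _ _ _ (mxi 0%N) int0).
have icX := integrable_tcos (xi n) g t c (mxi n) eX.
have isX := integrable_tsin (xi n) g t c (mxi n) eX.
have icW := integrable_tcos W g t (n%:R * c) mW IH1.
have isW := integrable_tsin W g t (n%:R * c) mW IH1.
have mc := measurable_tcos g t; have ms := measurable_tsin g t.
have [icc cc] := expectation_indepM W (xi n) _ _ indW (mc (n%:R * c)) (mc c) icW icX.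
have [ics cs] := expectation_indepM W (xi n) _ _ indW (mc (n%:R * c)) (ms c) icW isX.
have [isc sc] := expectation_indepM W (xi n) _ _ indW (ms (n%:R * c)) (mc c) isW icX.
have [iss ss] := expectation_indepM W (xi n) _ _ indW (ms (n%:R * c)) (ms c) isW isX.
have [iee _] := expectation_indepM W (xi n) _ _ indW (measurable_expZ g) (measurable_expZ g) IH1 eX.
have nS : n.+1%:R * c = n%:R * c + c by rewrite -natr1 mulrDl mul1r.
split.
  apply: eq_integrable iee => // w _.
  by rewrite /= walkS mulrDr expRD.
rewrite /= -IH2 /= -cX -sX; congr pair.
  under eq_Rintegral => w _ do rewrite walkS nS tcosD.
  by rewrite RintegralB// cc ss.
under eq_Rintegral => w _ do rewrite walkS nS tsinD.
by rewrite RintegralD// cs sc.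
Qed.

(** The case [t = 0] of the transform. *)
Lemma integral_exp_walk (xi : nat -> {RV P >-> R}) g n : iid xi ->
  P.-integrable setT (EFin \o (fun w => expR (g * xi 0%N w))) ->
  \int[P]_w expR (g * walk xi n w) = (\int[P]_w expR (g * xi 0%N w)) ^+ n.
Proof.
move=> h1 h2; have [_ /(congr1 fst) /=] := walk_transform xi g 0 0 n h1 h2.
have E (X : T -> R) : \int[P]_w tcos g 0 (n%:R * 0) (X w) = \int[P]_w expR (g * X w).
  by apply: eq_Rintegral => w _; rewrite /tcos mul0r cos0 mulr1.
have E1 (X : T -> R) : \int[P]_w tcos g 0 0 (X w) = \int[P]_w expR (g * X w).
  by apply: eq_Rintegral => w _; rewrite /tcos mul0r cos0 mulr1.
have E2 (X : T -> R) : \int[P]_w tsin g 0 0 (X w) = 0.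
  by under eq_Rintegral => w _ do rewrite /tsin mul0r sin0 mulr0; rewrite Rintegral_cst// mul0r.
by rewrite E E1 E2 cpow0.
Qed.

End walk_transform.

(** * Exponential moments and their derivatives *)
Section moments.
Context {R : realType} {d : measure_display} {T : measurableType d}
  {P : probability T R}.

Lemma expn_le_fact_expR (n : nat) (x : R) : 0 <= x -> x ^+ n <= n`!%:R * expR x.
Proof.
move=> x0; case: n => [|n].
  by rewrite expr0 fact0 mul1r -expR0 ler_expR.
rewrite mulrC -ler_pdivrMr ?ltr0n ?fact_gt0//.
by apply: le_trans (expR_ge1Dxn n x0); rewrite lerDr.
Qed.

(** A bound independent of [g] in a compact subset of ]0, +oo[, by which
    moments can be differentiated under the integral sign.  For [x < 0] the
    decay of [expR (g * x)] absorbs [|x| ^+ n]; for [x >= 0] this power is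
    absorbed by an extra factor [expR x]. *)
Lemma expn_expR_le (n : nat) (a b g x : R) : 0 < a -> a <= g -> g <= b ->
  `|x| ^+ n * expR (g * x) <= n`!%:R * (a ^- n + expR ((b + 1) * x)).
Proof.
move=> a0 ag gb.
have f0 : 0 <= n`!%:R :> R by rewrite ler0n.
have [x0|x0] := leP 0 x.
  rewrite ger0_norm// mulrDr ler_wpDl//.
    by rewrite mulr_ge0// invr_ge0 exprn_ge0// ltW.
  apply: (@le_trans _ _ (n`!%:R * expR x * expR (g * x))).
    by rewrite ler_wpM2r ?expR_ge0// expn_le_fact_expR.
  rewrite -mulrA ler_wpM2l// -expRD ler_expR -[x in x + _]mul1r -mulrDl.
  by rewrite ler_wpM2r// addrC lerD2r.
rewrite ltr0_norm// mulrDr; apply: ler_wpDr; first by rewrite mulr_ge0 ?expR_ge0.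
have y0 : 0 <= - x by lra.
rewrite ler_pdivlMr ?exprn_gt0//.
have -> : (- x) ^+ n * expR (g * x) * a ^+ n = (a * - x) ^+ n * expR (g * x).
  by rewrite exprMn; ring.
apply: (@le_trans _ _ (n`!%:R * expR (a * - x) * expR (g * x))).
  by rewrite ler_wpM2r ?expR_ge0// expn_le_fact_expR// mulr_ge0// ltW.
rewrite -mulrA ler_piMr// -expRD -expR0 ler_expR.
have : 0 <= (g - a) * (- x) by rewrite mulr_ge0// subr_ge0.
lra.
Qed.

Variable X : {RV P >-> R}.
Hypothesis Xexp : forall g : R, 0 < g ->
  P.-integrable setT (EFin \o (fun w => expR (g * X w))).

Lemma measurable_moment (n : nat) g : measurable_fun setT (fun w => X w ^+ n * expR (g * X w)).
Proof.
apply: measurable_funM; first exact: measurable_funX.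
exact: measurableT_comp (measurable_expZ g) _.
Qed.

Lemma integrable_moment_bound (n : nat) (a b : R) : 0 < a -> 0 < b ->
  P.-integrable setT (EFin \o (fun w => n`!%:R * (a ^- n + expR ((b + 1) * X w)))).
Proof.
move=> a0 b0; have b1 : 0 < b + 1 by rewrite addr_gt0.
have h := integrableD measurableT (finite_measure_integrable_cst P (a ^- n) measurableT) (Xexp _ b1).
have := integrableZl measurableT n`!%:R h.
by apply: eq_integrable.
Qed.

Lemma integrable_abs_moment (n : nat) g : 0 < g ->
  P.-integrable setT (EFin \o (fun w => `|X w| ^+ n * expR (g * X w))).
Proof.
move=> g0; apply: integrable_dominated (integrable_moment_bound n g g g0 g0) => [|w].
  apply: measurable_funM; last exact: measurableT_comp (measurable_expZ g) _.
  by apply: measurable_funX; exact: measurableT_comp.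
by rewrite ger0_norm ?mulr_ge0 ?expR_ge0// expn_expR_le.
Qed.

Lemma integrable_moment (n : nat) g : 0 < g ->
  P.-integrable setT (EFin \o (fun w => X w ^+ n * expR (g * X w))).
Proof.
move=> g0; apply: integrable_dominated (integrable_abs_moment n g g0) => [|w].
  exact: measurable_moment.
by rewrite normrM normrX (ger0_norm (expR_ge0 _)).
Qed.

Definition moment (n : nat) (g : R) : R := \int[P]_w (X w ^+ n * expR (g * X w)).

(** Differentiation under the integral sign on ]g / 2, 2 * g[. *)
Lemma is_derive_moment (n : nat) (g : R) : 0 < g -> is_derive g 1 (moment n) (moment n.+1 g).
Proof.
move=> g0.
pose f (x : R) (w : T) := X w ^+ n * expR (x * X w).
have df (x : R) (w : T) : is_derive x 1 (f^~ w) (X w ^+ n.+1 * expR (x * X w)).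
  have h : is_derive x 1 (fun y : R => y * X w) (X w).
    by apply: is_derive_eq; rewrite scaler0 add0r scaler1.
  have h1 := @is_derive1_comp _ expR (fun y : R => y * X w) _ _ _ (is_derive_expR (x * X w)) h.
  have h2 := is_deriveZ (X w ^+ n) h1.
  apply: (is_derive_eq h2).
  by rewrite /GRing.scale/= exprSr; ring.
have E (x : R) (w : T) : partial1of2 f x w = X w ^+ n.+1 * expR (x * X w).
  by rewrite partial1of2E; have := df x w => /@derive_val ->.
pose G w := (n.+1)`!%:R * ((g / 2) ^- n.+1 + expR ((2 * g + 1) * X w)).
have h2 : 0 < g / 2 by rewrite divr_gt0.
have h3 : 0 < 2 * g by rewrite mulr_gt0.
have Ig : `]g / 2, 2 * g[%classic g by rewrite /= in_itv/=; apply/andP; split; lra.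
have intf x : `]g / 2, 2 * g[%classic x -> P.-integrable setT (EFin \o f x).
  rewrite /= in_itv/= => /andP[x1 x2]; apply: integrable_moment; lra.
have drv x w : `]g / 2, 2 * g[%classic x -> setT w -> derivable (f^~ w) x 1.
  by move=> _ _; have := df x w => /@ex_derive.
have G0 w : 0 <= G w.
  by rewrite mulr_ge0// addr_ge0 ?expR_ge0// invr_ge0 exprn_ge0// ltW.
have Gi : P.-integrable setT (EFin \o G) by exact: integrable_moment_bound.
have Gub x w : `]g / 2, 2 * g[%classic x -> setT w -> `|partial1of2 f x w| <= G w.
  rewrite /= in_itv/= => /andP[x1 x2] _.
  rewrite E normrM normrX (ger0_norm (expR_ge0 _)).
  by apply: expn_expR_le => //; exact: ltW.
apply: DeriveDef.
  exact: (derivable_under_integral measurableT Ig intf drv G0 Gi Gub).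
rewrite -derive1E (differentiation_under_integral measurableT Ig intf drv G0 Gi Gub).
by apply: eq_Rintegral => w _; rewrite E.
Qed.

End moments.

(** * Atoms of an integer-valued variable *)
Section atoms.
Context {R : realType} {d : measure_display} {T : measurableType d}
  {P : probability T R}.
Variable X : {RV P >-> R}.
Hypothesis Xint : forall w, X w \is a Num.int.

Definition atom (m : int) : R := fine (P (X @^-1` [set m%:~R])).

Lemma atomE m : P (X @^-1` [set m%:~R]) = (atom m)%:E.
Proof. by rewrite fineK// fin_num_measure. Qed.

Lemma atom_ge0 m : 0 <= atom m.
Proof. by rewrite fine_ge0. Qed.

Lemma measurable_atom m : measurable (X @^-1` [set m%:~R]).
Proof. by rewrite -[X in measurable X]setTI; exact: measurable_funP. Qed.

(** There are only countably many integers. *)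
Lemma null_values (B : int -> Prop) : (forall m, B m -> atom m = 0) ->
  P.-negligible [set w | exists2 m, B m & X w = m%:~R].
Proof.
move=> B0.
pose F (n : nat) : set T := if (choice.unpickle n : option int) is Some m then
  (if `[< B m >] then X @^-1` [set m%:~R] else set0) else set0.
have H : P.-negligible (\bigcup_n F n).
  apply: negligible_bigcup => n; rewrite /F.
  case: choice.unpickle => [m|]; last exact: negligible_set0.
  case: asboolP => Bm; last exact: negligible_set0.
  apply/negligibleP; first exact: measurable_atom.
  by have := atomE m; rewrite B0.
apply: negligibleS H => w /= [m Bm Xw].
by exists (choice.pickle m) => //; rewrite /F choice.pickleK; case: asboolP.
Qed.

Lemma exists_atom (B : int -> Prop) :
  ~ P.-negligible [set w | exists2 m, B m & X w = m%:~R] ->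
  exists2 m, B m & 0 < atom m.
Proof.
move=> H; apply: contrapT => H2; apply: H; apply: null_values => m Bm.
apply/eqP; rewrite eq_le atom_ge0 andbT leNgt; apply/negP => m0.
by apply: H2; exists m.
Qed.

Lemma exists_value w : exists m : int, X w = m%:~R.
Proof. by have /intrP[m ->] := Xint w; exists m. Qed.

Lemma exists_positive_atom : exists m, 0 < atom m.
Proof.
have [|m _ m0] := exists_atom (fun=> True); last by exists m.
rewrite (_ : [set w | _] = setT); last first.
  by apply/seteqP; split => // w _; have [m Xm] := exists_value w; exists m.
move=> /negligibleP /= => /(_ measurableT); rewrite probability_setT => -[] /eqP.
by rewrite oner_eq0.
Qed.

(** Markov's inequality for the event that [X] hits an atom. *)
Lemma atom_le_integral (h : R -> R) m : (forall x, 0 <= h x) ->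
  measurable_fun setT h -> P.-integrable setT (EFin \o (h \o X)) ->
  h m%:~R * atom m <= \int[P]_w h (X w).
Proof.
move=> h0 mh hi; set A := X @^-1` [set m%:~R].
have mA : measurable A := measurable_atom m.
have iA := integrable_indic P mA.
have -> : h m%:~R * atom m = \int[P]_w (h m%:~R * \1_A w).
  rewrite RintegralZl//; congr (_ * _); rewrite /Rintegral integral_indic//.
  by rewrite setIT.
apply: le_Rintegral => //.
  have := integrableZl measurableT (h m%:~R) iA.
  by apply: eq_integrable.
move=> w _; rewrite indicE; have [|_] := boolP (w \in A); last by rewrite mulr0.
by rewrite inE /A /= => ->; rewrite mulr1.
Qed.

End atoms.

(** * Derivatives of the cumulant *)
Section cumulant_derivatives.
Context {R : realType} {d : measure_display} {T : measurableType d}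
  {P : probability T R}.
Variable X : {RV P >-> R}.
Hypothesis Xint : forall w, X w \is a Num.int.
Hypothesis Xexp : forall g : R, 0 < g ->
  P.-integrable setT (EFin \o (fun w => expR (g * X w))).

Lemma moment0E g : moment X 0 g = \int[P]_w expR (g * X w).
Proof. by apply: eq_Rintegral => w _; rewrite expr0 mul1r. Qed.

Lemma atom_le_moment0 m g : 0 < g -> atom X m * expR (g * m%:~R) <= moment X 0 g.
Proof.
move=> g0; rewrite moment0E mulrC; apply: (atom_le_integral X (fun x => expR (g * x))).
- by move=> x; exact: expR_ge0.
- exact: measurable_expZ.
- exact: Xexp.
Qed.

Lemma moment0_gt0 g : 0 < g -> 0 < moment X 0 g.
Proof.
move=> g0; have [m m0] := exists_positive_atom X Xint.
by apply: lt_le_trans (atom_le_moment0 m g g0); rewrite mulr_gt0 ?expR_gt0.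
Qed.

Lemma cumulantE : cumulant X = (@ln R) \o moment X 0.
Proof.
apply/funext => g; rewrite /cumulant /= moment0E /mmt_gen_fun unlock.
by congr (ln (fine _)); apply: eq_integral => w _; rewrite /= mulrC.
Qed.

Lemma is_derive_cumulant (g : R) : 0 < g ->
  is_derive g 1 (cumulant X) (moment X 1 g / moment X 0 g).
Proof.
move=> g0; rewrite cumulantE.
have h := @is_derive1_comp _ (@ln R) (moment X 0) _ _ _
  (is_derive1_ln (moment0_gt0 g g0)) (is_derive_moment X Xexp 0 g g0).
by apply: (is_derive_eq h); rewrite mulrC.
Qed.

Lemma derive1_cumulant (g : R) : 0 < g ->
  (cumulant X)^`()%classic g = moment X 1 g / moment X 0 g.
Proof. by move=> g0; rewrite derive1E; have := is_derive_cumulant g g0 => /@derive_val. Qed.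

Lemma derive2_cumulant (g : R) : 0 < g ->
  (cumulant X)^`(2)%classic g = moment X 2 g / moment X 0 g - (moment X 1 g / moment X 0 g) ^+ 2.
Proof.
move=> g0; have m0 := moment0_gt0 g g0.
have h := is_deriveM (is_derive_moment X Xexp 1 g g0)
  (is_deriveV (lt0r_neq0 m0) (is_derive_moment X Xexp 0 g g0)).
rewrite derive1nS derive1n1 derive1E.
rewrite (_ : 'D_1 _ g = 'D_1 (moment X 1 * (fun y => (moment X 0 y)^-1)) g); last first.
  apply: near_eq_derive.
  near=> x; apply: derive1_cumulant; near: x; exact: lt_nbhsr.
rewrite (@derive_val _ _ _ _ _ _ _ h) /GRing.scale/=.
by field; rewrite lt0r_neq0.
Unshelve. all: by end_near. Qed.

End cumulant_derivatives.

(** * Existence of the critical exponent *)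
Section gamma_star_existence.
Context {R : realType} {d : measure_display} {T : measurableType d}
  {P : probability T R}.
Variable X : {RV P >-> R}.
Hypothesis Xint : forall w, X w \is a Num.int.
Hypothesis Xexp : forall g : R, 0 < g ->
  P.-integrable setT (EFin \o (fun w => expR (g * X w))).
Hypothesis Xmean : P.-integrable setT (EFin \o (fun w => `|X w|)).

(* [h' = (g * L' g - L g - ln 2) / g ^+ 2], so the critical points of [h] are
   exactly the solutions of the equation for gamma_star. *)
Let h (g : R) := (cumulant X g + ln 2) / g.

Lemma is_derive_slope (g : R) : 0 < g ->
  is_derive g 1 h ((g * (cumulant X)^`()%classic g - (cumulant X g + ln 2)) / g ^+ 2).
Proof.
move=> g0.
have h1 : is_derive g 1 (fun x => cumulant X x + ln 2) (moment X 1 g / moment X 0 g).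
  have h2 := is_deriveD (is_derive_cumulant X Xint Xexp g g0) (is_derive_cst (ln 2 : R) g 1).
  by apply: (is_derive_eq h2); rewrite addr0.
have h2 := is_deriveM h1 (is_deriveV (lt0r_neq0 g0) (is_derive_id g (1 : R))).
apply: (is_derive_eq h2); rewrite derive1_cumulant//.
rewrite /GRing.scale/=; field; rewrite !lt0r_neq0//; exact: moment0_gt0.
Qed.

(** A continuous function on [[lo, hi]] which is smaller at an inner point than
    at both ends attains its minimum inside, where its derivative vanishes. *)
Lemma slope_critical (lo g1 hi : R) : 0 < lo -> lo < g1 -> g1 < hi ->
  h g1 < h lo -> h g1 < h hi -> exists g, is_gamma_star X g.
Proof.
move=> lo0 log1 g1hi hlo hhi.
have drv x : x \in `[lo, hi] -> derivable h x 1.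
  rewrite in_itv/= => /andP[x1 _].
  by have := is_derive_slope x (lt_le_trans lo0 x1) => /@ex_derive.
have [|c chi cmin] := @EVT_min R h lo hi (ltW (lt_trans log1 g1hi)).
  exact: derivable_within_continuous.
have hg1 : h c <= h g1 by apply: cmin; rewrite in_itv/= !ltW.
have cin : c \in `]lo, hi[.
  move: chi; rewrite !in_itv/= => /andP[c1 c2].
  rewrite !lt_neqAle c1 c2 !andbT; apply/andP; split; apply/eqP => E.
    by move: (le_lt_trans hg1 hlo); rewrite E ltxx.
  by move: (le_lt_trans hg1 hhi); rewrite E ltxx.
have c0 : 0 < c by apply: lt_trans lo0 _; move: cin; rewrite in_itv/= => /andP[].
have hc : is_derive c 1 h 0.
  apply: (derive1_at_min (ltW (lt_trans log1 g1hi))) cin _ => t /subset_itv_oo_cc tin.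
    exact: drv.
  exact: cmin.
exists c; split => //.
have : (c * (cumulant X)^`()%classic c - (cumulant X c + ln 2)) / c ^+ 2 = 0.
  by have := is_derive_slope c c0 => /@derive_val <-; have := hc => /@derive_val.
move/eqP; rewrite mulf_eq0 invr_eq0 expf_eq0/= (gt_eqF c0) orbF subr_eq0 => /eqP ->.
by rewrite lnV ?posrE//; ring.
Qed.

(** By [expR y >= 1 + y] and the finite mean, [phi g >= 1 - g * E |X|], so for
    small [g] the numerator stays above [ln (3 / 2)] while the denominator
    tends to 0. *)
Lemma slope_near_zero (M : R) : exists2 e : R, 0 < e &
  forall g, 0 < g -> g < e -> M < h g.
Proof.
pose a := \int[P]_w `|X w|.
have a0 : 0 <= a by apply: Rintegral_ge0.
have phi g : 0 < g -> 1 - g * a <= moment X 0 g.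
  move=> g0; rewrite moment0E.
  have PT : fine (P setT) = 1 by rewrite probability_setT.
  have i1 := finite_measure_integrable_cst P (1 : R) measurableT.
  have i2 := integrableZl measurableT g Xmean.
  have -> : 1 - g * a = \int[P]_w (1 - g * `|X w|).
    rewrite RintegralB// RintegralZl// Rintegral_cst//.
    by rewrite PT mulr1.
  apply: le_Rintegral => //; [exact: (integrableB measurableT i1 i2)|exact: Xexp|].
  move=> w _; apply: le_trans (expR_ge1Dx _).
  rewrite lerD2l lerNl -mulrN ler_wpM2l ?(ltW g0)//.
  by rewrite -normrN ler_norm.
have l0 : 0 < ln (3 / 2 : R) by rewrite ln_gt0//; lra.
(* The first bound ensures [g * a <= 1 / 4], hence [2 * phi g >= 3 / 2]. *)
pose e := Num.min ((4 * (a + 1))^-1) (ln (3 / 2) / (`|M| + 1)).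
have M1 : 0 < `|M| + 1 by rewrite ltr_wpDl.
exists e; first by rewrite lt_min invr_gt0 divr_gt0// mulr_gt0// ltr_wpDl.
move=> g g0; rewrite lt_min => /andP[g1 g2].
have ga : g * a <= 4^-1.
  have a1 : 0 < a + 1 by rewrite ltr_wpDl.
  apply: (@le_trans _ _ ((4 * (a + 1))^-1 * (a + 1))).
    by apply: ler_pM => //; [exact: ltW|exact: ltW|lra].
  by rewrite invfM mulfVK ?gt_eqF.
apply: (@lt_le_trans _ _ (ln (3 / 2) / g)).
  rewrite ltr_pdivlMr// mulrC; apply: (@le_lt_trans _ _ (g * (`|M| + 1))).
    by rewrite (ler_wpM2l (ltW g0))// (le_trans (ler_norm M))// lerDl.
  by rewrite -ltr_pdivlMr.
rewrite /h ler_wpM2r ?invr_ge0 ?(ltW g0)// cumulantE /= -lnM ?posrE ?moment0_gt0//.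
have := phi g g0; rewrite ler_ln ?posrE ?mulr_gt0 ?moment0_gt0//; lra.
Qed.

(** An atom [m] gives [phi g >= P (X = m) * expR (g * m)], so the lower limit of
    [h] at infinity is at least [m]. *)
Lemma slope_near_infinity (m : int) (M : R) : 0 < atom X m -> M < m%:~R ->
  exists2 K : R, 0 < K & forall g, K < g -> M < h g.
Proof.
move=> m0 Mm; pose D := m%:~R - M.
have D0 : 0 < D by rewrite subr_gt0.
pose c := ln (atom X m) + ln 2.
exists ((`|c| + 1) / D); first by rewrite divr_gt0// ltr_wpDl.
move=> g; rewrite ltr_pdivrMr// => gK.
have g0 : 0 < g.
  rewrite -(pmulr_lgt0 _ D0); apply: lt_trans gK; by rewrite ltr_wpDl.
rewrite /h ltr_pdivlMr// cumulantE /=.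
apply: (@lt_le_trans _ _ (ln (atom X m * expR (g * m%:~R)) + ln 2)).
  rewrite lnM ?posrE ?expR_gt0// expRK.
  have : - c <= `|c| by rewrite -normrN ler_norm.
  rewrite /D /c in gK *; lra.
by rewrite lerD2r ler_ln ?posrE ?mulr_gt0 ?expR_gt0 ?moment0_gt0// atom_le_moment0.
Qed.

(** Reduces existence to a single comparison: [h] has to take a value below
    some atom [m]. *)
Lemma gamma_star_exists_from (g1 : R) (m : int) : 0 < g1 -> 0 < atom X m ->
  h g1 < m%:~R -> exists g, is_gamma_star X g.
Proof.
move=> g10 m0 hm.
have [e e0 He] := slope_near_zero (h g1).
have [K K0 HK] := slope_near_infinity m (h g1) m0 hm.
pose lo := Num.min e g1 / 2.
have mn : 0 < Num.min e g1 by rewrite lt_min e0.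
have [l1 l2] : Num.min e g1 <= e /\ Num.min e g1 <= g1 by rewrite !ge_min !lexx orbT.
apply: (slope_critical lo g1 (Num.max K g1 + 1)).
- by rewrite divr_gt0.
- rewrite /lo; lra.
- by rewrite ltr_pwDr// le_max lexx orbT.
- by apply: He; rewrite /lo; lra.
- by apply: HK; rewrite ltr_pwDr// le_max lexx.
Qed.

End gamma_star_existence.

Section gamma_star_spec.
Context {R : realType} {d : measure_display} {T : measurableType d}
  {P : probability T R}.
Variable X : {RV P >-> R}.
Hypothesis Xint : forall w, X w \is a Num.int.
Hypothesis Xexp : forall g : R, 0 < g ->
  P.-integrable setT (EFin \o (fun w => expR (g * X w))).
Hypothesis Xmean : P.-integrable setT (EFin \o (fun w => `|X w|)).

Lemma upper_bound_gt (x : R) : (x%:E < upper_bound X)%E ->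
  exists2 m : int, 0 < atom X m & x < m%:~R.
Proof.
move=> /ereal_sup_gt[_ [m /= Pm <-]]; rewrite lte_fin => xm; exists m => //.
by move: Pm; rewrite atomE lte_fin.
Qed.

Lemma atom_le_upper_bound (m : int) : 0 < atom X m -> (m%:~R%:E <= upper_bound X)%E.
Proof.
by move=> m0; apply: ereal_sup_ubound; exists m => //=; rewrite atomE lte_fin.
Qed.

Lemma upper_bound_attained : (upper_bound X < +oo)%E ->
  exists2 m : int, 0 < atom X m & upper_bound X = (m%:~R)%:E.
Proof.
move=> fin.
have [m0 Hm0] := exists_positive_atom X Xint.
have := atom_le_upper_bound m0 Hm0.
case E : (upper_bound X) fin => [u| |] //= _ _.
have [m Hm um] : exists2 m : int, 0 < atom X m & u - 2^-1 < m%:~R.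
  by apply: upper_bound_gt; rewrite E lte_fin; lra.
exists m => //; rewrite -E; apply/eqP; rewrite eq_le atom_le_upper_bound// andbT.
apply: ge_ereal_sup => _ [k /= Pk <-]; rewrite lee_fin ler_int.
have Hk : 0 < atom X k by move: Pk; rewrite atomE lte_fin.
have := atom_le_upper_bound k Hk; rewrite E lee_fin => ku.
rewrite -ltzD1 -(ltr_int R) intrD; lra.
Qed.

(** A value other than the top atom [m] is at most [m - 1], so
    [expR (g * (X - m))] is at most [1_(X = m) + expR (- g)]. *)
Lemma moment0_le_atom (m : int) (g : R) : 0 < g -> upper_bound X = (m%:~R)%:E ->
  moment X 0 g * expR (- (g * m%:~R)) <= atom X m + expR (- g).
Proof.
move=> g0 Em.
have mA := measurable_atom X m.
set A := X @^-1` [set m%:~R] in mA.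
have iA := integrable_indic P mA.
have ia : P.-integrable setT (EFin \o (fun w => \1_A w + expR (- g))).
  have := integrableD measurableT iA (finite_measure_integrable_cst P (expR (- g)) measurableT).
  exact: eq_integrable.
have iX : P.-integrable setT (EFin \o (fun w => expR (g * X w) * expR (- (g * m%:~R)))).
  by have := integrableZr measurableT (expR (- (g * m%:~R))) (Xexp g g0); exact: eq_integrable.
have PT : fine (P setT) = 1 by rewrite probability_setT.
have -> : atom X m + expR (- g) = \int[P]_w (\1_A w + expR (- g)).
  rewrite RintegralD//; last exact: finite_measure_integrable_cst.
  rewrite Rintegral_cst// PT mulr1; congr (_ + _).
  by rewrite /Rintegral integral_indic// setIT.
rewrite moment0E -RintegralZr//; last exact: Xexp.
apply: fine_le; [exact: integrable_fin_num|exact: integrable_fin_num|].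
apply: ae_ge0_le_integral.
- by [].
- by move=> w _; rewrite lee_fin mulr_ge0 ?expR_ge0.
- exact: measurable_int iX.
- by move=> w _; rewrite lee_fin addr_ge0 ?expR_ge0// indicE.
- exact: measurable_int ia.
have : P.-negligible [set w | exists2 k : int, (m < k)%R & X w = k%:~R].
  apply: null_values => k mk; apply/eqP; rewrite eq_le atom_ge0 andbT leNgt.
  apply/negP => k0; have := atom_le_upper_bound k k0.
  by rewrite Em lee_fin ler_int leNgt mk.
apply: negligibleS => w /= H0.
have H : ~ ((expR (g * X w) * expR (- (g * m%:~R)))%:E <= (\1_A w + expR (- g))%:E)%E.
  by move=> h; apply: H0 => _.
have [k Xk] := exists_value X Xint w; exists k => //; rewrite ltNge; apply/negP => km.
apply: H; rewrite lee_fin -expRD indicE.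
have [|wA] := boolP (w \in A).
  rewrite inE /A /= => ->; rewrite subrr expR0 lerDl expR_ge0//.
rewrite add0r ler_expR Xk.
have km' : k <= m - 1.
  rewrite -ltzD1 subrK lt_neqAle km andbT; apply: contraNneq wA => Ekm.
  by rewrite inE /A /= Xk Ekm.
have : (k%:~R : R) <= m%:~R - 1 by rewrite (_ : m%:~R - 1 = (m - 1)%:~R) ?ler_int// intrD rmorphN.
move=> km2; have : g * k%:~R <= g * (m%:~R - 1) by rewrite ler_wpM2l// ltW.
lra.
Qed.

(** If the law is unbounded, any atom above [h 1] does.  If the top atom [m] has
    mass [p < 1 / 2], then [2 * phi g * expR (- (g * m)) <= 2 * (p + expR (- g))]
    drops below 1 for large [g], that is, [h g < m]. *)
Lemma gamma_star_spec :
  upper_bound X = +oo%E \/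
    ((upper_bound X < +oo)%E /\
     (P [set w | (X w)%:E = upper_bound X] < (2^-1)%:E)%E) ->
  is_gamma_star X (gamma_star X).
Proof.
move=> H; suff : exists g, is_gamma_star X g by case=> g; exact: getI.
case: H => [E|[fin]].
  have [|m m0 mh] := upper_bound_gt ((cumulant X 1 + ln 2) / 1).
    by rewrite E ltry.
  exact: (gamma_star_exists_from X Xint Xexp Xmean 1 m ltr01 m0 mh).
have [m m0 Em] := upper_bound_attained fin.
rewrite Em (_ : [set w | _] = X @^-1` [set m%:~R]); last first.
  by apply/seteqP; split => w /= => [[]|->].
rewrite atomE lte_fin => pm.
have D0 : 0 < 2^-1 - atom X m by rewrite subr_gt0.
pose g := (2^-1 - atom X m)^-1 + 1.
have g0 : 0 < g by rewrite addr_gt0// invr_gt0.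
apply: (gamma_star_exists_from X Xint Xexp Xmean g m g0 m0).
rewrite ltr_pdivrMr// cumulantE /= -lnM ?posrE ?moment0_gt0//.
rewrite -(expRK (m%:~R * g)) ltr_ln ?posrE ?mulr_gt0 ?moment0_gt0 ?expR_gt0//.
have h1 := moment0_le_atom m g g0 Em.
have h2 : expR (- g) < 2^-1 - atom X m.
  rewrite expRN -[ltRHS]invrK ltf_pV2 ?posrE ?invr_gt0 ?expR_gt0//.
  apply: lt_le_trans (expR_ge1Dx g); rewrite /g; lra.
have h3 : moment X 0 g * expR (- (g * m%:~R)) < 2^-1 by lra.
rewrite expRN ltr_pdivrMr ?expR_gt0// in h3.
by rewrite [m%:~R * g]mulrC; lra.
Qed.

End gamma_star_spec.

(** * Subgroups of the integers *)
Section integer_subgroups.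

(** Euclidean division by the least positive element; [h = 0] is the trivial
    subgroup. *)
Lemma int_subgroup_principal (D : int -> Prop) :
  D 0 -> (forall a b, D a -> D b -> D (a - b)) ->
  exists2 h : nat, D h%:Z & forall a, D a -> exists k : int, a = k * h%:Z.
Proof.
move=> D0 DB.
have DN a : D a -> D (- a) by move=> /(DB _ _ D0); rewrite sub0r.
have DD a b : D a -> D b -> D (a + b) by move=> Da /DN /(DB _ _ Da); rewrite opprK.
have DMn a (n : nat) : D a -> D (n%:Z * a).
  move=> Da; elim: n => [|n IH]; first by rewrite mul0r.
  by rewrite intS mulrDl mul1r; apply: DD.
have DM a k : D a -> D (k * a).
  by move=> Da; case: k => n; [exact: DMn|rewrite NegzE mulNr; apply/DN/DMn].
pose Q (n : nat) := `[< (0 < n)%N /\ D n%:Z >].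
have [exQ|H] := pselect (exists n, Q n); last first.
  exists 0%N => // a Da; exists 0; rewrite mul0r; apply/eqP/negPn/negP => a0.
  apply: H; exists `|a|%N; apply/asboolP; split; first by rewrite absz_gt0.
  have [a1|a1] := leP 0 a; first by rewrite gez0_abs.
  by rewrite ltz0_abs//; exact: DN.
case: (ex_minnP exQ) => h /asboolP[h0 Dh] hmin.
exists h => // a Da; exists (a %/ h%:Z)%Z.
have Dr : D (a %% h%:Z)%Z by rewrite /modz; apply: DB => //; exact: DM.
have hz : h%:Z != 0 by lia.
have r0 := modz_ge0 a hz; have rh := ltz_mod a hz.
have : (a %% h%:Z)%Z = 0.
  apply/eqP/negPn/negP => rn.
  have : (h <= `|(a %% h%:Z)%Z|)%N.
    apply: hmin; apply/asboolP; rewrite gez0_abs//; split => //; lia.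
  lia.
by rewrite {2}(divz_eq a h%:Z) => ->; rewrite addr0.
Qed.

End integer_subgroups.

(** * The tilted characteristic function away from 0 *)
Section transform_bounds.
Context {R : realType} {d : measure_display} {T : measurableType d}
  {P : probability T R}.

Lemma integrable_RD (f h : T -> R) : P.-integrable setT (EFin \o f) ->
  P.-integrable setT (EFin \o h) -> P.-integrable setT (EFin \o (fun w => f w + h w)).
Proof. by move=> fi hi; exact: eq_integrable (integrableD measurableT fi hi). Qed.

Lemma integrable_RB (f h : T -> R) : P.-integrable setT (EFin \o f) ->
  P.-integrable setT (EFin \o h) -> P.-integrable setT (EFin \o (fun w => f w - h w)).
Proof. by move=> fi hi; exact: eq_integrable (integrableB measurableT fi hi). Qed.

Lemma integrable_RZ k (f : T -> R) : P.-integrable setT (EFin \o f) ->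
  P.-integrable setT (EFin \o (fun w => k * f w)).
Proof. by move=> fi; exact: eq_integrable (integrableZl measurableT k fi). Qed.

Variable X : {RV P >-> R}.
Hypothesis Xint : forall w, X w \is a Num.int.
Hypothesis Xexp : forall g : R, 0 < g ->
  P.-integrable setT (EFin \o (fun w => expR (g * X w))).
Variable g : R.
Hypothesis g0 : 0 < g.

Let phi := moment X 0 g.
Let phi0 : 0 < phi. Proof. exact: moment0_gt0. Qed.
Let iW : P.-integrable setT (EFin \o (fun w => expR (g * X w))).
Proof. exact: Xexp. Qed.
Let mX : measurable_fun setT X. Proof. by []. Qed.

(** The real and imaginary parts of the characteristic function of [X - c]
    under the law tilted by [expR (g * X)]. *)
Definition zcos (c t : R) : R := (\int[P]_w tcos g t c (X w)) / moment X 0 g.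
Definition zsin (c t : R) : R := (\int[P]_w tsin g t c (X w)) / moment X 0 g.

(* The tilted squared distance of [expR (i * t * (x - c))] to its tilted mean
   [Z = zcos c t + i * zsin c t]. *)
Let defect (c t x : R) : R := expR (g * x) *
  ((cos (t * (x - c)) - zcos c t) ^+ 2 + (sin (t * (x - c)) - zsin c t) ^+ 2).

Lemma defectE c t x : defect c t x =
  (1 + zcos c t ^+ 2 + zsin c t ^+ 2) * expR (g * x)
  - (2 * zcos c t * tcos g t c x + 2 * zsin c t * tsin g t c x).
Proof.
rewrite /defect /tcos /tsin; have := cos2Dsin2 (t * (x - c)).
set a := cos _; set b := sin _; set e := expR _ => ab.
have -> : (a - zcos c t) ^+ 2 + (b - zsin c t) ^+ 2 =
    1 + zcos c t ^+ 2 + zsin c t ^+ 2 - (2 * zcos c t * a + 2 * zsin c t * b).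
  apply/eqP; rewrite -subr_eq0; apply/eqP; rewrite -[RHS](subrr (1 : R)) -[X in X - 1]ab.
  by ring.
by ring.
Qed.

Let itcos c t : P.-integrable setT (EFin \o (fun w => tcos g t c (X w))).
Proof. exact: integrable_tcos. Qed.
Let itsin c t : P.-integrable setT (EFin \o (fun w => tsin g t c (X w))).
Proof. exact: integrable_tsin. Qed.

Lemma integrable_defect c t : P.-integrable setT (EFin \o (defect c t \o X)).
Proof.
rewrite (_ : defect c t \o X = fun w => (1 + zcos c t ^+ 2 + zsin c t ^+ 2) * expR (g * X w)
  - (2 * zcos c t * tcos g t c (X w) + 2 * zsin c t * tsin g t c (X w))); last first.
  by apply/funext => w /=; rewrite defectE.
by apply: integrable_RB; [|apply: integrable_RD]; apply: integrable_RZ.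
Qed.

Lemma measurable_defect c t : measurable_fun setT (defect c t).
Proof.
rewrite (_ : defect c t = fun x => (1 + zcos c t ^+ 2 + zsin c t ^+ 2) * expR (g * x)
  - (2 * zcos c t * tcos g t c x + 2 * zsin c t * tsin g t c x)); last first.
  by apply/funext => x; rewrite defectE.
apply: measurable_funB; last apply: measurable_funD; apply: measurable_funM => //.
- exact: measurable_expZ.
- exact: measurable_tcos.
- exact: measurable_tsin.
Qed.

Lemma defect_ge0 c t x : 0 <= defect c t x.
Proof. by rewrite mulr_ge0 ?expR_ge0// addr_ge0 ?sqr_ge0. Qed.

(** For a unit complex variable [U] with mean [Z], the variance
    [E (|U - Z| ^+ 2)] is [1 - |Z| ^+ 2]; here the mean is a tilted one, whence
    the factor [phi]. *)
Lemma integral_defect c t :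
  \int[P]_w defect c t (X w) = phi * (1 - (zcos c t ^+ 2 + zsin c t ^+ 2)).
Proof.
under eq_Rintegral => w _ do rewrite defectE.
rewrite RintegralB//; [|exact: integrable_RZ|by apply: integrable_RD; apply: integrable_RZ].
rewrite RintegralD//; [|exact: integrable_RZ..].
rewrite !RintegralZl//.
have -> : \int[P]_w tcos g t c (X w) = phi * zcos c t.
  by rewrite /zcos mulrC divfK// gt_eqF.
have -> : \int[P]_w tsin g t c (X w) = phi * zsin c t.
  by rewrite /zsin mulrC divfK// gt_eqF.
by rewrite -moment0E -/phi; ring.
Qed.

(** Two atoms [a] and [b] each contribute a fixed fraction of the variance
    [1 - |Z| ^+ 2], so [expR (i * t * a)] and [expR (i * t * b)], after
    centring, are both close to [Z] and hence to each other. *)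
Lemma atoms_defect c (a b : int) : 0 < atom X a -> 0 < atom X b ->
  exists C : R, forall t, 1 - cos (t * (a - b)%:~R) <=
    C * (1 - (zcos c t ^+ 2 + zsin c t ^+ 2)).
Proof.
move=> a0 b0.
pose wa := expR (g * a%:~R) * atom X a; pose wb := expR (g * b%:~R) * atom X b.
have wa0 : 0 < wa by rewrite mulr_gt0 ?expR_gt0.
have wb0 : 0 < wb by rewrite mulr_gt0 ?expR_gt0.
exists (phi / wa + phi / wb) => t.
have H (m : int) : 0 < atom X m ->
    (cos (t * (m%:~R - c)) - zcos c t) ^+ 2 + (sin (t * (m%:~R - c)) - zsin c t) ^+ 2 <=
    phi / (expR (g * m%:~R) * atom X m) * (1 - (zcos c t ^+ 2 + zsin c t ^+ 2)).
  move=> m0; have w0 : 0 < expR (g * m%:~R) * atom X m by rewrite mulr_gt0 ?expR_gt0.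
  have := atom_le_integral X (defect c t) m (defect_ge0 c t) (measurable_defect c t) (integrable_defect c t).
  rewrite integral_defect /defect mulrAC => h.
  by rewrite mulrAC ler_pdivlMr// mulrC.
have := H a a0; have := H b b0; rewrite mulrDl -/wa -/wb.
have -> : t * (a - b)%:~R = t * (a%:~R - c) - t * (b%:~R - c).
  by rewrite intrD rmorphN /=; ring.
rewrite cosB; have := cos2Dsin2 (t * (a%:~R - c)); have := cos2Dsin2 (t * (b%:~R - c)).
set x := cos (t * (a%:~R - c)); set y := sin (t * (a%:~R - c)).
set x' := cos (t * (b%:~R - c)); set y' := sin (t * (b%:~R - c)).
set A := zcos c t; set B := zsin c t.
set u := phi / wa * _; set v := phi / wb * _ => h1 h2 h3 h4.
have := sqr_ge0 (x + x' - 2 * A); have := sqr_ge0 (y + y' - 2 * B).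
have := sqr_ge0 (x - x'); have := sqr_ge0 (y - y').
have E1 : (x - x') ^+ 2 + (x + x' - 2 * A) ^+ 2 = 2 * (x - A) ^+ 2 + 2 * (x' - A) ^+ 2 by ring.
have E2 : (y - y') ^+ 2 + (y + y' - 2 * B) ^+ 2 = 2 * (y - B) ^+ 2 + 2 * (y' - B) ^+ 2 by ring.
have E3 : (x - x') ^+ 2 + (y - y') ^+ 2 = 2 * (1 - (x * x' + y * y')).
  rewrite (_ : 2 * _ = (x ^+ 2 + y ^+ 2) + (x' ^+ 2 + y' ^+ 2) - 2 * (x * x' + y * y')); last by rewrite h1 h2; ring.
  by ring.
lra.
Qed.

Hypothesis Xspan : maximal_span_one X.

(** The integers [d] for which [1 - cos (t * d)] is bounded by a multiple of
    [1 - |Z t| ^+ 2], uniformly in [t], form a subgroup [D] of the integers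
    ([one_sub_cosD]).  It contains the differences of atoms, so if it were
    generated by some [h != 1] then [X] would live on a coset of a proper
    subgroup.  Hence [1 \in D], and [1 - cos t >= t ^+ 2 / 8] on [[0, pi]].
    The quadratic gap is thus obtained near 0 and away from it at once. *)
Lemma span_one_transform c : exists2 k : R, 0 < k & forall t, 0 <= t -> t <= pi ->
  zcos c t ^+ 2 + zsin c t ^+ 2 <= 1 - k * t ^+ 2.
Proof.
pose D (a : int) := exists C : R, forall t, 1 - cos (t * a%:~R) <=
    C * (1 - (zcos c t ^+ 2 + zsin c t ^+ 2)).
have D0 : D 0 by exists 0 => t; rewrite mulr0 cos0 subrr mul0r.
have DB a b : D a -> D b -> D (a - b).
  move=> [C HC] [C' HC']; exists (2 * C + 2 * C') => t.
  rewrite intrD mulrDr (le_trans (one_sub_cosD _ _))//.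
  rewrite rmorphN/= mulrN cosN; have := HC t; have := HC' t; lra.
have [h Dh Dall] := int_subgroup_principal D D0 DB.
have [a a0] := exists_positive_atom X Xint.
have atoms (k : nat) : (forall b, D b -> exists j : int, b = j * k%:Z) ->
    P [set w | exists j : int, X w = (a + j * k%:Z)%:~R] = 1%E.
  move=> Hk; set E := [set w | _].
  have nE : P.-negligible (~` E).
    have := null_values X (fun b => ~ exists j : int, b = a + j * k%:Z).
    have H b : ~ (exists j : int, b = a + j * k%:Z) -> atom X b = 0.
      move=> Hb; apply/eqP; rewrite eq_le atom_ge0 andbT leNgt; apply/negP => b0.
      have [j jE] := Hk _ (atoms_defect c b a b0 a0).
      by apply: Hb; exists j; rewrite -jE addrC subrK.
    move=> /(_ H); apply: negligibleS => w /= Hw.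
    have [b Xb] := exists_value X Xint w; exists b => // -[j bE].
    by apply: Hw; exists j; rewrite Xb bE.
  have mE : measurable E.
    rewrite (_ : E = X @^-1` (range (fun j : int => (a + j * k%:Z)%:~R))); last first.
      by apply/seteqP; split => w /= [j]; [exists j|move=> _ Xw; exists j].
    rewrite -[Y in measurable Y]setTI; apply: mX => //.
    exact/countable_measurable/(sub_countable (card_image_le _ _))/countableP.
  have := probability_setC P (measurableC mE); rewrite setCK => ->.
  by rewrite (measure_negligible (measurableC mE) nE) sube0.
(* [h = 0] means that [X] is almost surely constant, and then it lives on a
   coset of any proper subgroup, such as the even integers. *)
have h1 : h = 1%N.
  case: h Dh Dall => [|[|h]] // Dh Dall; exfalso.
    have := Xspan 2%N a isT; rewrite atoms ?ltxx// => b /Dall[j ->].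
    by exists 0; rewrite mulr0 mul0r.
  by have := Xspan h.+2 a isT; rewrite atoms ?ltxx.
have [C HC] : D 1 by move: Dh; rewrite h1.
have q0 t : 0 <= 1 - (zcos c t ^+ 2 + zsin c t ^+ 2).
  rewrite -(pmulr_rge0 _ phi0) -integral_defect; apply: Rintegral_ge0 => w _.
  exact: defect_ge0.
have key t : 0 <= t -> t <= pi -> t ^+ 2 / 8 <= C * (1 - (zcos c t ^+ 2 + zsin c t ^+ 2)).
  by move=> t0 tp; apply: le_trans (one_sub_cos_ge t t0 tp) _; rewrite -[in cos t](mulr1 t).
have C0 : 0 < C.
  rewrite ltNge; apply/negP => C0.
  have := key pi (pi_ge0 R) (lexx _); have : 0 < (pi : R) ^+ 2 by rewrite exprn_gt0// pi_gt0.
  have := mulr_le0_ge0 C0 (q0 pi); lra.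
exists (8 * C)^-1; first by rewrite invr_gt0 mulr_gt0.
move=> t t0 tp; have := key t t0 tp; rewrite [C * _]mulrC -ler_pdivrMr//.
have -> : (8 * C)^-1 * t ^+ 2 = t ^+ 2 / 8 / C by field; rewrite gt_eqF.
lra.
Qed.

End transform_bounds.

(** * The tilted characteristic function near 0 *)
Section transform_taylor.
Context {R : realType} {d : measure_display} {T : measurableType d}
  {P : probability T R}.
Variable X : {RV P >-> R}.
Hypothesis Xint : forall w, X w \is a Num.int.
Hypothesis Xexp : forall g : R, 0 < g ->
  P.-integrable setT (EFin \o (fun w => expR (g * X w))).
Variable g : R.
Hypothesis g0 : 0 < g.

(** Mean and variance of [X] under the law tilted by [expR (g * X)]; they are
    the first two derivatives of the cumulant at [g]. *)
Definition tmean : R := moment X 1 g / moment X 0 g.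
Definition tvar : R := moment X 2 g / moment X 0 g - tmean ^+ 2.

Let phi := moment X 0 g.
Let phi0 : 0 < phi. Proof. exact: moment0_gt0. Qed.
Let rho := tmean.
Let Y (w : T) : R := X w - rho.
Let W (w : T) : R := expR (g * X w).

Let iM n : P.-integrable setT (EFin \o (fun w => X w ^+ n * W w)).
Proof. exact: integrable_moment. Qed.
Let iW : P.-integrable setT (EFin \o W).
Proof. exact: Xexp. Qed.
Let iX1 : P.-integrable setT (EFin \o (fun w => X w * W w)).
Proof. exact: (iM 1). Qed.

Lemma integral_center1 : P.-integrable setT (EFin \o (fun w => Y w * W w)) /\
  \int[P]_w (Y w * W w) = 0.
Proof.
have E : (fun w => Y w * W w) = (fun w => X w * W w - rho * W w).
  by apply/funext => w; rewrite mulrBl.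
rewrite E; have i2 := integrable_RZ rho W iW.
split; first exact: integrable_RB.
rewrite RintegralB// RintegralZl// -moment0E -/phi.
rewrite -[X in X - _]/(moment X 1 g).
by rewrite /rho /tmean -/phi divfK ?subrr// gt_eqF.
Qed.

Lemma integral_center2 : P.-integrable setT (EFin \o (fun w => Y w ^+ 2 * W w)) /\
  \int[P]_w (Y w ^+ 2 * W w) = phi * tvar.
Proof.
have E : (fun w => Y w ^+ 2 * W w) =
    (fun w => X w ^+ 2 * W w - (2 * rho * (X w * W w) - rho ^+ 2 * W w)).
  by apply/funext => w; rewrite /Y; ring.
rewrite E; have i1 := integrable_RZ (2 * rho) _ iX1; have i2 := integrable_RZ (rho ^+ 2) W iW.
have i3 := integrable_RB _ _ i1 i2.
split; first exact: integrable_RB.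
rewrite RintegralB// RintegralB// !RintegralZl// -moment0E -/phi.
rewrite -[X in X - _]/(moment X 2 g) -[X in 2 * rho * X]/(moment X 1 g).
rewrite /tvar /rho /tmean -/phi; field; by rewrite gt_eqF.
Qed.

Let cube (w : T) : R := `|Y w| ^+ 3 * W w.

(** By convexity, [(a + b) ^+ 3 <= 4 * (a ^+ 3 + b ^+ 3)] for [a, b >= 0]. *)
Lemma integrable_cube : P.-integrable setT (EFin \o cube).
Proof.
have i1 := integrable_RZ 4 _ (integrable_abs_moment X Xexp 3 g g0).
have i2 := integrable_RZ (4 * `|rho| ^+ 3) W iW.
apply: integrable_dominated (integrable_RD _ _ i1 i2) => [|w].
  apply: measurable_funM; last exact: measurableT_comp (measurable_expZ g) _.
  apply: measurable_funX; apply: measurableT_comp => //.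
  exact: measurable_funB.
rewrite /cube ger0_norm; last by rewrite mulr_ge0 ?expR_ge0// exprn_ge0.
rewrite -/(W w) mulrA -mulrDl ler_wpM2r ?expR_ge0//.
have h := ler_normB (X w) rho.
apply: (@le_trans _ _ ((`|X w| + `|rho|) ^+ 3)); first by rewrite lerXn2r ?nnegrE ?addr_ge0.
rewrite -subr_ge0.
have -> : 4 * `|X w| ^+ 3 + 4 * `|rho| ^+ 3 - (`|X w| + `|rho|) ^+ 3 =
   3 * ((`|X w| + `|rho|) * (`|X w| - `|rho|) ^+ 2) by ring.
by rewrite mulr_ge0 // mulr_ge0 ?addr_ge0 ?sqr_ge0.
Qed.

Let icos t : P.-integrable setT (EFin \o (fun w => tcos g t rho (X w))).
Proof. by apply: integrable_tcos => //; exact: Xexp. Qed.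
Let isin t : P.-integrable setT (EFin \o (fun w => tsin g t rho (X w))).
Proof. by apply: integrable_tsin => //; exact: Xexp. Qed.

Lemma zcosE t : \int[P]_w tcos g t rho (X w) = phi * zcos X g rho t.
Proof. by rewrite /zcos mulrC divfK// gt_eqF. Qed.
Lemma zsinE t : \int[P]_w tsin g t rho (X w) = phi * zsin X g rho t.
Proof. by rewrite /zsin mulrC divfK// gt_eqF. Qed.

(** The pointwise expansions [cos_sub_le] and [sin_sub_le] are integrated under
    the tilted law.  Centring at its mean removes the linear term, so the
    imaginary part is of third order. *)
Lemma transform_taylor : exists2 K : R, 0 <= K & forall t, 0 <= t ->
  `|zcos X g rho t - (1 - t ^+ 2 * tvar / 2)| <= K * t ^+ 3 /\
  `|zsin X g rho t| <= K * t ^+ 3.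
Proof.
have k0 : 0 <= \int[P]_w cube w.
  by apply: Rintegral_ge0 => w _; rewrite mulr_ge0 ?expR_ge0// exprn_ge0.
exists ((\int[P]_w cube w) / phi); first by rewrite divr_ge0// ltW.
move=> t t0.
have [i1 e1] := integral_center1; have [i2 e2] := integral_center2.
have i3 := integrable_RZ (t ^+ 3) _ integrable_cube.
have bound (f : T -> R) (v : R) : P.-integrable setT (EFin \o f) ->
    \int[P]_w f w = phi * v -> (forall w, `|f w| <= t ^+ 3 * cube w) ->
    `|v| <= (\int[P]_w cube w) / phi * t ^+ 3.
  move=> fi fE fle; rewrite mulrAC ler_pdivlMr// -{1}(gtr0_norm phi0) -normrM mulrC -fE.
  apply: (le_trans (le_normr_Rintegral measurableT fi)).
  rewrite mulrC -RintegralZl//; last exact: integrable_cube.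
  apply: le_Rintegral => //.
  by have := integrable_abse fi; exact: eq_integrable.
split.
  have i4 := integrable_RB _ _ iW (integrable_RZ (t ^+ 2 / 2) _ i2).
  apply: (bound (fun w => tcos g t rho (X w) - (W w - t ^+ 2 / 2 * (Y w ^+ 2 * W w)))).
  - exact: integrable_RB.
  - rewrite RintegralB// RintegralB//; last exact: integrable_RZ.
    by rewrite RintegralZl// e2 zcosE -moment0E -/phi; field.
  - move=> w; rewrite /tcos -/(W w) /cube.
    have -> : W w * cos (t * (X w - rho)) - (W w - t ^+ 2 / 2 * (Y w ^+ 2 * W w)) =
      (cos (t * Y w) - (1 - (t * Y w) ^+ 2 / 2)) * W w by rewrite /Y; field.
    rewrite normrM (ger0_norm (expR_ge0 _)) mulrA ler_wpM2r ?expR_ge0//.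
    by apply: (le_trans (cos_sub_le _)); rewrite normrM (ger0_norm t0) exprMn.
apply: (bound (fun w => tsin g t rho (X w) - t * (Y w * W w))).
- by apply: integrable_RB => //; exact: integrable_RZ.
- rewrite RintegralB//; last exact: integrable_RZ.
  by rewrite RintegralZl// e1 zsinE mulr0 subr0.
- move=> w; rewrite /tsin -/(W w) /cube.
  have -> : W w * sin (t * (X w - rho)) - t * (Y w * W w) = (sin (t * Y w) - t * Y w) * W w.
    by rewrite /Y; ring.
  rewrite normrM (ger0_norm (expR_ge0 _)) mulrA ler_wpM2r ?expR_ge0//.
  by apply: (le_trans (sin_sub_le _)); rewrite normrM (ger0_norm t0) exprMn.
Qed.

Lemma zcos_ge t : 1 - t ^+ 2 * tvar / 2 <= zcos X g rho t.
Proof.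
have [i2 e2] := integral_center2.
rewrite -(ler_pM2l phi0) -zcosE.
have i3 := integrable_RZ (t ^+ 2 / 2) _ i2; have i4 := integrable_RB _ _ iW i3.
have -> : phi * (1 - t ^+ 2 * tvar / 2) = \int[P]_w (W w - t ^+ 2 / 2 * (Y w ^+ 2 * W w)).
  by rewrite RintegralB// RintegralZl// e2 -moment0E -/phi; field.
apply: le_Rintegral => // w _.
have := one_sub_cos_le (t * (X w - rho)).
move=> /(ler_wpM2r (expR_ge0 (g * X w))).
by rewrite /tcos -/(Y w) -/(W w) exprMn; lra.
Qed.

Hypothesis Xspan : maximal_span_one X.

(** The gap constant has to be at most the variance for the Gaussian of the
    gap to dominate the limiting one.  This comes for free: at [t = 1],
    [1 - k >= zcos ^+ 2 >= 2 * zcos - 1 >= 1 - tvar]. *)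
Lemma transform_gap : exists2 k : R, 0 < k & k <= tvar /\
  forall t, 0 <= t -> t <= pi -> zcos X g rho t ^+ 2 + zsin X g rho t ^+ 2 <= 1 - k * t ^+ 2.
Proof.
have [k k0 Hk] := span_one_transform X Xint Xexp g g0 Xspan rho.
exists k => //; split => //.
have p1 : 1 <= (pi : R) by have := pi_ge2 R; lra.
have := Hk 1 ler01 p1; have := zcos_ge 1.
rewrite expr1n mul1r mulr1; set A := zcos _ _ _ _; set B := zsin _ _ _ _.
have := sqr_ge0 B; have := sqr_ge0 (A - 1).
rewrite [(A - 1) ^+ 2]sqrrB !expr2; lra.
Qed.

End transform_taylor.

(** * Gaussian integrals *)
Section gaussian_integrals.
Context {R : realType}.
Let mu := @lebesgue_measure R.

Definition gauss (a t : R) : R := expR (- (a * t ^+ 2)).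

Lemma is_derive_gauss (a c t : R) :
  is_derive t 1 (fun x => c * gauss a x) (c * (- (2 * a * t) * gauss a t)).
Proof.
have h : is_derive t 1 (fun x : R => - (a * x ^+ 2)) (- (2 * a * t)).
  apply: is_derive_eq; rewrite /GRing.scale/=; ring.
have h1 := @is_derive1_comp _ expR (fun x : R => - (a * x ^+ 2)) _ _ _ (is_derive_expR (- (a * t ^+ 2))) h.
have h2 := is_deriveZ c h1.
by apply: (is_derive_eq h2); rewrite /GRing.scale/= /gauss; ring.
Qed.

Lemma continuous_gauss (a : R) : continuous (gauss a).
Proof.
apply: (derivable_continuous_at _ (fun t => - (2 * a * t) * gauss a t)) => t.
have := is_derive_gauss a 1 t; rewrite !mul1r; by under eq_fun do rewrite mul1r.
Qed.

Lemma cvg_gauss (a : R) : 0 < a -> gauss a x @[x --> +oo] --> (0 : R).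
Proof.
move=> a0; apply/cvgrPdist_lt => e e0; near=> x.
have x1 : 1 <= x by near: x; exact: nbhs_pinfty_ge.
have xe : (a * e)^-1 < x by near: x; apply: nbhs_pinfty_gt; rewrite num_real.
have x0 : 0 < x by lra.
rewrite sub0r normrN ger0_norm ?expR_ge0// /gauss expRN.
rewrite -[ltRHS]invrK ltf_pV2 ?posrE ?invr_gt0 ?expR_gt0//.
apply: lt_le_trans (expR_ge1Dx _).
apply: (@lt_le_trans _ _ (a * x)).
  by rewrite [a * x]mulrC -ltr_pdivrMr// mulrC -invfM.
apply: (@le_trans _ _ (a * x ^+ 2)); last by rewrite lerDr.
by rewrite ler_pM2l// expr2 ler_peMr// ltW.
Unshelve. all: by end_near. Qed.

Lemma integral_linear_gauss (a x : R) : 0 < a -> 0 <= x ->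
  (\int[mu]_(t in `[x, +oo[) (t * gauss a t)%:E = (gauss a x / (2 * a))%:E)%E.
Proof.
move=> a0 x0.
pose c := - (2 * a)^-1.
have D (t : R) : is_derive t 1 (fun y => c * gauss a y) (t * gauss a t).
  by apply: (is_derive_eq (is_derive_gauss a c t)); rewrite /c; field; rewrite gt_eqF.
have C : continuous (fun t : R => t * gauss a t).
  by move=> t; apply: cvgM; [exact: cvg_id|exact: continuous_gauss].
rewrite (@ge0_continuous_FTC2y R _ (fun y : R => c * gauss a y) x 0).
- by rewrite -EFinB sub0r /c mulNr opprK mulrC.
- by move=> t xt; rewrite mulr_ge0 ?expR_ge0// (le_trans x0).
- exact: continuous_subspaceT.
- rewrite -(mulr0 c); apply: cvgM; [exact: cvg_cst|exact: cvg_gauss].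
- by move=> t _; have := D t => /@ex_derive.
- apply: cvg_at_right_filter; apply: (derivable_continuous_at _ _ D).
- by move=> t _; rewrite derive1E; have := D t => /@derive_val.
Qed.

Lemma measurable_gauss a : measurable_fun setT (gauss a).
Proof. by apply: continuous_measurable_fun; exact: continuous_gauss. Qed.

(** Half the total mass of a normal density with variance [(2 * a)^-1]. *)
Lemma integral_gauss_half (a : R) : 0 < a ->
  (\int[mu]_(t in `[0%R, +oo[) (gauss a t)%:E = (Num.sqrt (pi / a) / 2)%:E)%E.
Proof.
move=> a0.
(* [gauss a] is the normal density of standard deviation [s], up to a factor. *)
pose s := Num.sqrt (2 * a)^-1.
have s2 : s ^+ 2 = (2 * a)^-1 by rewrite sqr_sqrtr// invr_ge0 mulr_ge0// ltW.
have s0 : s != 0 by rewrite gt_eqF// sqrtr_gt0 invr_gt0 mulr_gt0.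
have E t : normal_pdf 0 s t = normal_peak s * gauss a t.
  rewrite normal_pdfE// /normal_fun subr0 s2 /gauss; congr (_ * expR _).
  by rewrite -mulr_natr; field; rewrite gt_eqF.
have pk : normal_peak s = (Num.sqrt (pi / a))^-1.
  rewrite /normal_peak s2; congr (Num.sqrt _)^-1.
  by rewrite -mulr_natr; field; rewrite gt_eqF.
have p0 : 0 < Num.sqrt (pi / a) by rewrite sqrtr_gt0 divr_gt0// pi_gt0.
have h := @integral_normal_pdf R 0 s.
have sym := @ge0_symfun_integralT R (normal_pdf 0 s) (normal_pdf_ge0 0 s) (continuous_normal_pdf s0).
rewrite sym in h; last by move=> t /=; rewrite !E /gauss sqrrN.
have e : (\int[mu]_(t in `[0%R, +oo[) (normal_pdf 0 s t)%:E =
   (normal_peak s)%:E * \int[mu]_(t in `[0%R, +oo[) (gauss a t)%:E)%E.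
  under eq_integral do rewrite E EFinM.
  rewrite ge0_integralZl//.
  - by apply/measurable_EFinP/measurable_funTS; exact: measurable_gauss.
  - by move=> t _; rewrite lee_fin expR_ge0.
  - by rewrite lee_fin normal_peak_ge0.
rewrite (_ : [set x | 0 <= x] = `[0, +oo[%classic) in h; last first.
  by apply/seteqP; split => x/=; rewrite in_itv/= andbT.
rewrite e pk in h.
move: h; case: (integral _ _ _) => [r| |] h.
- move: h; rewrite -!EFinM => -[h]; congr EFin.
  have : 2 * r = Num.sqrt (pi / a).
    move: h; set p := Num.sqrt _ in p0 * => h.
    have -> : 2 * r = 2 * (p^-1 * r) * p by field; rewrite gt_eqF.
    by rewrite h mul1r.
  lra.
- by move: h; rewrite gt0_muley ?lte_fin ?invr_gt0// gt0_muley ?lte_fin.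
- by move: h; rewrite gt0_muleNy ?lte_fin ?invr_gt0// gt0_muleNy ?lte_fin.
Qed.

End gaussian_integrals.

Section gaussian_on_0pi.
Context {R : realType}.
Let mu := @lebesgue_measure R.
Let I : set R := `[0, pi]%classic.

Let mI : measurable I. Proof. exact: measurable_itv. Qed.

Lemma integrable_continuous_0pi (f : R -> R) : continuous f -> mu.-integrable I (EFin \o f).
Proof.
move=> cf; apply: continuous_compact_integrable; first exact: segment_compact.
exact: continuous_subspaceT.
Qed.

Lemma continuous_linear_gauss (a : R) : continuous (fun t : R => t * gauss a t).
Proof. by move=> t; apply: cvgM; [exact: cvg_id|exact: continuous_gauss]. Qed.

Lemma measurable_linear_gauss (a : R) :
  measurable_fun setT (fun t : R => (t * gauss a t)%:E).
Proof.
apply/measurable_EFinP; apply: continuous_measurable_fun.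
exact: continuous_linear_gauss.
Qed.

Lemma integral_linear_gauss_0pi (a : R) : 0 < a ->
  \int[mu]_(t in I) (t * gauss a t) <= (2 * a)^-1.
Proof.
move=> a0; rewrite -lee_fin fineK; last first.
  exact: integrable_fin_num (integrable_continuous_0pi _ (continuous_linear_gauss a)).
have e := integral_linear_gauss a 0 a0 (lexx _).
rewrite /gauss expr0n/= mulr0 oppr0 expR0 mul1r in e; rewrite -e.
apply: ge0_subset_integral; [exact: measurable_itv|exact: measurable_itv|..].
- by apply: measurable_funTS; exact: measurable_linear_gauss.
- move=> t; rewrite /= in_itv/= andbT => t0; rewrite lee_fin mulr_ge0 ?expR_ge0//.
- by move=> t; rewrite /I /= !in_itv/= andbT => /andP[].
Qed.

(** The missing part of the half-line lies in [t >= 1], where the Gaussian is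
    dominated by [t * gauss a t], which has an explicit primitive. *)
Lemma integral_gauss_0pi (a : R) : 0 < a ->
  `|\int[mu]_(t in I) gauss a t - Num.sqrt (pi / a) / 2| <= (2 * a)^-1.
Proof.
move=> a0; have p2 := pi_ge2 R.
have fin : (\int[mu]_(t in I) (gauss a t)%:E)%E \is a fin_num.
  apply: integrable_fin_num => //; apply: integrable_continuous_0pi.
  exact: continuous_gauss.
have mg : measurable_fun setT (EFin \o gauss a) by apply/measurable_EFinP; exact: measurable_gauss.
have g0 t : (0 <= (gauss a t)%:E)%E by rewrite lee_fin expR_ge0.
have e : (\int[mu]_(t in `[0%R, +oo[) (gauss a t)%:E =
    \int[mu]_(t in I) (gauss a t)%:E + \int[mu]_(t in `]pi, +oo[) (gauss a t)%:E)%E.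
  rewrite (_ : `[0, +oo[%classic = I `|` `]pi, +oo[%classic); last first.
    apply/seteqP; split => x/=; rewrite /I/= !in_itv/= !andbT.
      by move=> x0; case: (leP x pi) => xp; [left; rewrite x0|right].
    by move=> [/andP[]//|]; lra.
  rewrite ge0_integral_setU//; first exact: measurable_funTS.
  apply/disj_setPS => x /= []; rewrite /I/= !in_itv/= andbT => /andP[_ xp].
  by move=> /(le_lt_trans xp); rewrite ltxx.
have tail : (\int[mu]_(t in `]pi, +oo[) (gauss a t)%:E <= (2 * a)^-1%:E)%E.
  apply: (@le_trans _ _ (gauss a pi / (2 * a))%:E); last first.
    rewrite lee_fin ler_piMl ?invr_ge0//; first lra.
    by rewrite -expR0 ler_expR oppr_le0 mulr_ge0 ?sqr_ge0// ltW.
  rewrite -integral_linear_gauss//; last by lra.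
  apply: (@le_trans _ _ (\int[mu]_(t in `]pi, +oo[) (t * gauss a t)%:E)%E).
    apply: ge0_le_integral => //.
    - exact: measurable_funTS.
    - by apply: measurable_funTS; exact: measurable_linear_gauss.
    - move=> t; rewrite /= in_itv/= andbT => t0.
      by rewrite lee_fin ler_peMl ?expR_ge0//; lra.
  apply: ge0_subset_integral; [exact: measurable_itv|exact: measurable_itv|..].
  - by apply: measurable_funTS; exact: measurable_linear_gauss.
  - move=> t; rewrite /= in_itv/= andbT => t0; rewrite lee_fin mulr_ge0 ?expR_ge0//; lra.
  - by move=> t; rewrite /= !in_itv/= !andbT => /ltW.
have tail0 : (0 <= \int[mu]_(t in `]pi, +oo[) (gauss a t)%:E)%E by apply: integral_ge0.
rewrite integral_gauss_half// in e.
move: tail tail0 e; rewrite -[X in (_ = X + _)%E](fineK fin) -/(Rintegral _ _ _).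
case: (\int[mu]_(t in `]pi, +oo[) _)%E => [r| |] //; rewrite !lee_fin -EFinD => r1 r0 [->].
by rewrite opprD addrA subrr sub0r normrN ger0_norm.
Qed.

(** [u * expR (- u) <= 1] for [u = a * t ^+ 2]: half of the exponent of the
    Gaussian pays for a factor [t ^+ 2]. *)
Lemma sqr_gauss_le (a t : R) : 0 < a -> t ^+ 2 * gauss (2 * a) t <= a^-1 * gauss a t.
Proof.
move=> a0; rewrite -(ler_pM2l a0) mulrA mulVKf ?gt_eqF//.
have -> : gauss (2 * a) t = gauss a t * gauss a t.
  by rewrite /gauss -expRD; congr expR; ring.
rewrite [gauss a t * _]mulrC mulrA ler_piMl ?expR_ge0//.
rewrite /gauss expRN ler_pdivrMr ?expR_gt0// mul1r.
by apply: le_trans (expR_ge1Dx _); rewrite lerDr.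
Qed.

End gaussian_on_0pi.

(** * Laplace asymptotics of the inversion integral *)
Section fourier_laplace.
Context {R : realType}.

Lemma sqrt_gauss_constant (p s N : R) : 0 < p -> 0 < s -> 0 < N ->
  (Num.sqrt (2 * p) * Num.sqrt s)^-1 = Num.sqrt N / p * (Num.sqrt (p / (s / 2 * N)) / 2).
Proof.
move=> p0 s0 N0.
have e1 : p / (s / 2 * N) = (2 * p) / (s * N) by field; rewrite !gt_eqF.
have tp0 : 0 < 2 * p by rewrite mulr_gt0.
have sn0 : 0 <= s * N by rewrite mulr_ge0 ?ltW.
rewrite e1 (sqrtrM _ (ltW tp0)) (sqrtrV sn0) (sqrtrM N (ltW s0)).
have P2 : 2 * p = Num.sqrt (2 * p) * Num.sqrt (2 * p).
  by rewrite -expr2 sqr_sqrtr ?ltW.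
have q0 : 0 < Num.sqrt (2 * p) by rewrite sqrtr_gt0.
have q1 : 0 < Num.sqrt s by rewrite sqrtr_gt0.
have q2 : 0 < Num.sqrt N by rewrite sqrtr_gt0.
move: P2 q0 q1 q2; move: (Num.sqrt _) => q; move: (Num.sqrt _) => r; move: (Num.sqrt _) => m.
move=> P2 q0 r0 m0.
have -> : p = q * q / 2 by rewrite -P2; field.
by field; rewrite !gt_eqF.
Qed.

Let mu := @lebesgue_measure R.
Let I : set R := `[0, pi]%classic.
Variables (A B : R -> R) (k s2 K : R).
Hypotheses (k0 : 0 < k) (ks : k <= s2) (K0 : 0 <= K).
Hypothesis gap : forall t : R, 0 <= t -> t <= pi -> A t ^+ 2 + B t ^+ 2 <= 1 - k * t ^+ 2.
Hypothesis taylor : forall t : R, 0 <= t ->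
  `|A t - (1 - t ^+ 2 * s2 / 2)| <= K * t ^+ 3 /\ `|B t| <= K * t ^+ 3.

(** The real part of [Z ^+ n * expR (- i * t * b)] for [Z = A t + i * B t]. *)
Definition phase_part (n : nat) (b t : R) : R :=
  (cpow (A t) (B t) n).1 * cos (t * b) + (cpow (A t) (B t) n).2 * sin (t * b).

Let s20 : 0 < s2. Proof. exact: lt_le_trans ks. Qed.
Let K1 := 2 * K + s2 ^+ 2 * pi / 4.
Let K2 := 2 * K1 * expR (k / 2 * pi ^+ 2).

Let K1_ge0 : 0 <= K1.
Proof.
by apply: addr_ge0; [exact: mulr_ge0|rewrite divr_ge0// mulr_ge0 ?sqr_ge0 ?pi_ge0].
Qed.

Let K2_ge0 : 0 <= K2.
Proof. by rewrite mulr_ge0 ?expR_ge0// mulr_ge0. Qed.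

(** Both [A] and the Gaussian agree with [1 - s2 * t ^+ 2 / 2] up to the third
    order; the quartic error of the Gaussian is cubic on [[0, pi]]. *)
Lemma transform_near_gauss t : 0 <= t -> t <= pi ->
  `|A t - gauss (s2 / 2) t| + `|B t| <= K1 * t ^+ 3.
Proof.
move=> t0 tp; have [hA hB] := taylor t t0.
pose x := s2 / 2 * t ^+ 2.
have x0 : 0 <= x by rewrite mulr_ge0 ?sqr_ge0// divr_ge0// ltW.
have hg : `|gauss (s2 / 2) t - (1 - x)| <= x ^+ 2 by exact: expRN_sub_le.
have hx : x ^+ 2 <= s2 ^+ 2 * pi / 4 * t ^+ 3.
  have -> : x ^+ 2 = s2 ^+ 2 / 4 * t ^+ 3 * t by rewrite /x; field.
  have -> : s2 ^+ 2 * pi / 4 * t ^+ 3 = s2 ^+ 2 / 4 * t ^+ 3 * pi by field.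
  by rewrite ler_wpM2l// mulr_ge0 ?exprn_ge0// divr_ge0 ?sqr_ge0.
have e : 1 - t ^+ 2 * s2 / 2 = 1 - x by rewrite /x; field.
rewrite e in hA.
have -> : A t - gauss (s2 / 2) t = (A t - (1 - x)) - (gauss (s2 / 2) t - (1 - x)) by ring.
have := ler_normB (A t - (1 - x)) (gauss (s2 / 2) t - (1 - x)).
rewrite /K1 !mulrDl; lra.
Qed.

Lemma gauss_pow (a t : R) n : gauss a t ^+ n = gauss (a * n%:R) t.
Proof. by rewrite /gauss -expRM_natl; congr expR; rewrite -mulr_natl; ring. Qed.

Lemma gauss_mono (a a' t : R) : a' <= a -> gauss a t <= gauss a' t.
Proof. by move=> aa; rewrite ler_expR lerN2 ler_wpM2r// sqr_ge0. Qed.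

(** [cpow_sub] with [M = gauss (k / 2) t], which bounds [|Z|] by the gap and
    [gauss (s2 / 2) t] because [k <= s2]; the phase costs [|b| * t].  Passing
    from [M ^+ n] to [M ^+ n.+1] costs at most the factor [1 / M pi]. *)
Lemma phase_part_near n b t : 0 <= t -> t <= pi ->
  `|phase_part n.+1 b t - gauss (s2 / 2 * n.+1%:R) t| <=
  (K2 * n.+1%:R * t ^+ 3 + `|b| * t) * gauss (k / 2 * n.+1%:R) t.
Proof.
move=> t0 tp; pose G := gauss (s2 / 2) t; pose M := gauss (k / 2) t.
have G0 : 0 <= G by exact: expR_ge0.
have M0 : 0 <= M by exact: expR_ge0.
have GM : G <= M by apply: gauss_mono; rewrite ler_wpM2r.
have M2 : A t ^+ 2 + B t ^+ 2 <= M ^+ 2.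
  apply: le_trans (gap t t0 tp) _; rewrite /M gauss_pow /gauss divfK//.
  by apply: le_trans (expR_ge1Dx _); rewrite lexx.
have [h1 h2] := cpow_sub (A t) (B t) G M n G0 GM M2.
have h3 := transform_near_gauss t t0 tp.
rewrite -!gauss_pow -/G -/M /phase_part.
set x := (cpow _ _ _).1 in h1 *; set y := (cpow _ _ _).2 in h2 *.
set e := `|A t - G| + `|B t| in h1 h2 h3.
have Mn : M ^+ n <= expR (k / 2 * pi ^+ 2) * M ^+ n.+1.
  rewrite (exprS M) mulrA ler_peMl ?exprn_ge0// /M /gauss -expRD -expR0 ler_expR.
  rewrite -mulrBr mulr_ge0//; first by rewrite divr_ge0// ltW.
  by rewrite subr_ge0 lerXn2r ?nnegrE ?pi_ge0.
have h4 : n.+1%:R * M ^+ n * e <= n.+1%:R * (expR (k / 2 * pi ^+ 2) * M ^+ n.+1) * (K1 * t ^+ 3).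
  apply: ler_pM => //; first by rewrite mulr_ge0 ?exprn_ge0.
  - by rewrite addr_ge0.
  - by rewrite ler_wpM2l.
have hb : `|cos (t * b) - 1| <= `|b| * t.
  rewrite distrC ger0_norm ?one_sub_cos_ge0//.
  by rewrite (le_trans (one_sub_cos_le_norm _))// normrM (ger0_norm t0) mulrC.
have -> : x * cos (t * b) + y * sin (t * b) - G ^+ n.+1 =
   (x - G ^+ n.+1) * cos (t * b) + y * sin (t * b) + G ^+ n.+1 * (cos (t * b) - 1) by ring.
have n1 : `|(x - G ^+ n.+1) * cos (t * b)| <= `|x - G ^+ n.+1|.
  by rewrite normrM ler_piMr// cos_max.
have n2 : `|y * sin (t * b)| <= `|y| by rewrite normrM ler_piMr// sin_max.
have n3 : `|G ^+ n.+1 * (cos (t * b) - 1)| <= M ^+ n.+1 * (`|b| * t).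
  rewrite normrM ger0_norm ?exprn_ge0// ler_pM ?exprn_ge0//.
  by rewrite lerXn2r ?nnegrE.
apply: (le_trans (ler_normD _ _)).
have := ler_normD ((x - G ^+ n.+1) * cos (t * b)) (y * sin (t * b)).
rewrite [(K2 * _ * _ + _) * _]mulrDl.
have -> : K2 * n.+1%:R * t ^+ 3 * M ^+ n.+1 =
  2 * (n.+1%:R * (expR (k / 2 * pi ^+ 2) * M ^+ n.+1) * (K1 * t ^+ 3)) by rewrite /K2; ring.
rewrite [X in _ + X]mulrC; lra.
Qed.

Lemma phase_part_le n b t : 0 <= t -> t <= pi ->
  `|phase_part n.+1 b t - gauss (s2 / 2 * n.+1%:R) t| <=
  (4 * K2 / k + `|b|) * (t * gauss (k / 4 * n.+1%:R) t).
Proof.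
move=> t0 tp; apply: (le_trans (phase_part_near n b t t0 tp)).
pose a := k / 4 * n.+1%:R.
have n0 : 0 < n.+1%:R :> R by rewrite ltr0n.
have a0 : 0 < a by rewrite mulr_gt0// divr_gt0.
have -> : k / 2 * n.+1%:R = 2 * a by rewrite /a; field.
have h := sqr_gauss_le a t a0.
have e1 : K2 * n.+1%:R * t ^+ 3 * gauss (2 * a) t <= 4 * K2 / k * (t * gauss a t).
  have -> : K2 * n.+1%:R * t ^+ 3 * gauss (2 * a) t =
    K2 * n.+1%:R * t * (t ^+ 2 * gauss (2 * a) t) by ring.
  have -> : 4 * K2 / k * (t * gauss a t) = K2 * n.+1%:R * t * (a^-1 * gauss a t).
    by rewrite /a; field; rewrite !gt_eqF.
  by rewrite ler_wpM2l// !mulr_ge0// ltW.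
have e2 : `|b| * t * gauss (2 * a) t <= `|b| * (t * gauss a t).
  by rewrite -mulrA !ler_wpM2l// gauss_mono//; lra.
by rewrite -/a; have := lerD e1 e2; rewrite -!mulrDl.
Qed.

(** The error bound of [phase_part_le] is a multiple of [t * gauss _ t] with a
    Gaussian of precision proportional to [n], whose integral is [O(1 / n)];
    the prefactor [sqrt n] leaves [O(1 / sqrt n)]. *)
Theorem fourier_laplace : exists2 C : R, 0 <= C & forall (n : nat) (b : R), (0 < n)%N ->
  mu.-integrable I (EFin \o phase_part n b) ->
  `|Num.sqrt n%:R / pi * \int[mu]_(t in I) phase_part n b t
    - (Num.sqrt (2 * pi) * Num.sqrt s2)^-1| <= C * (1 + `|b|) / Num.sqrt n%:R.
Proof.
have K20 : 0 <= 4 * K2 / k by rewrite divr_ge0 ?(ltW k0)// mulr_ge0.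
pose C0 := 4 * K2 / k.
exists ((1 + C0) * (2 / k) + s2^-1).
  by rewrite addr_ge0 ?mulr_ge0 ?invr_ge0 ?addr_ge0// ltW.
move=> [//|n] b _ iF.
have n0 : 0 < n.+1%:R :> R by rewrite ltr0n.
have p0 := pi_gt0 R.
have p1 : 1 <= pi :> R by have := pi_ge2 R; lra.
set N : R := n.+1%:R in n0 *.
pose a := s2 / 2 * N; pose a' := k / 4 * N.
have a0 : 0 < a by rewrite mulr_gt0// divr_gt0.
have a'0 : 0 < a' by rewrite mulr_gt0// divr_gt0.
have ig := integrable_continuous_0pi _ (continuous_gauss a).
have il := integrable_continuous_0pi _ (continuous_linear_gauss a').
set J := \int[mu]_(t in I) phase_part n.+1 b t.
pose D := C0 + `|b|.
have D0 : 0 <= D by rewrite addr_ge0.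
have h1 : `|J - \int[mu]_(t in I) gauss a t| <= D * (2 * a')^-1.
  have mI : measurable (I : set (measurableTypeR R)) by exact: measurable_itv.
  rewrite -RintegralB//.
  have iFg : mu.-integrable I (EFin \o (fun t => phase_part n.+1 b t - gauss a t)).
    by have := integrableB mI iF ig; exact: eq_integrable.
  apply: (le_trans (le_normr_Rintegral mI iFg)).
  apply: (@le_trans _ _ (D * \int[mu]_(t in I) (t * gauss a' t))); last first.
    by rewrite ler_wpM2l//; exact: integral_linear_gauss_0pi.
  rewrite -RintegralZl//; apply: le_Rintegral => //.
  - by have := integrable_abse iFg; exact: eq_integrable.
  - by have := integrableZl mI D il; exact: eq_integrable.
  - move=> t; rewrite /I/= in_itv/= => /andP[t0 tp].
    exact: phase_part_le.
have h2 := integral_gauss_0pi a a0.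
have sN : 0 < Num.sqrt N by rewrite sqrtr_gt0.
have NN : N = Num.sqrt N * Num.sqrt N by rewrite -expr2 sqr_sqrtr// ltW.
have main : (Num.sqrt (2 * pi) * Num.sqrt s2)^-1 = Num.sqrt N / pi * (Num.sqrt (pi / a) / 2).
  exact: sqrt_gauss_constant.
rewrite main -mulrBr normrM ger0_norm; last by rewrite divr_ge0// ltW.
have h3 : `|J - Num.sqrt (pi / a) / 2| <= D * (2 * a')^-1 + (2 * a)^-1.
  have -> : J - Num.sqrt (pi / a) / 2 = (J - \int[mu]_(t in I) gauss a t) +
     (\int[mu]_(t in I) gauss a t - Num.sqrt (pi / a) / 2) by ring.
  by apply: (le_trans (ler_normD _ _)); exact: lerD.
have h4 : Num.sqrt N / pi <= Num.sqrt N by rewrite ler_pdivrMr// ler_peMr// ltW.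
apply: (@le_trans _ _ (Num.sqrt N * (D * (2 * a')^-1 + (2 * a)^-1))).
  by apply: ler_pM => //; rewrite divr_ge0// ltW.
have -> : Num.sqrt N * (D * (2 * a')^-1 + (2 * a)^-1) = (D * (2 / k) + s2^-1) / Num.sqrt N.
  rewrite /a /a' {2 3}NN; field; rewrite !gt_eqF//.
rewrite ler_pM2r ?invr_gt0// [leRHS]mulrDl.
have := normr_ge0 b => b0.
apply: lerD.
  rewrite mulrAC ler_wpM2r//; first by rewrite divr_ge0// ltW.
  rewrite /D; have : 0 <= C0 * `|b| by rewrite mulr_ge0.
  lra.
by rewrite ler_peMr ?invr_ge0 ?(ltW s20)// lerDl.
Qed.

End fourier_laplace.

(** * Fourier inversion for the walk *)
Section orthogonality.
Context {R : realType}.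
Let mu := @lebesgue_measure R.
Let I : set (measurableTypeR R) := `[0, pi]%classic.

Lemma sin_pi_int (m : int) : sin (pi * m%:~R) = 0 :> R.
Proof.
have H (n : nat) : sin (pi * n%:R) = 0 :> R.
  elim: n => [|n IH]; first by rewrite mulr0 sin0.
  by rewrite -natr1 mulrDr mulr1 sinDpi IH oppr0.
case: m => n; first exact: H.
by rewrite NegzE rmorphN /= mulrN sinN H oppr0.
Qed.

(** Orthogonality over the half-period [[0, pi]], which is enough because only
    the even part of the characters is needed. *)
Lemma integral_cos_int (m : int) :
  (\int[mu]_(t in I) (cos (t * m%:~R))%:E = (if m == 0 then pi else 0)%:E)%E.
Proof.
have p0 := pi_gt0 R.
have [->|m0] := eqVneq m 0.
  under eq_integral do rewrite mulr0 cos0.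
  have mI : measurable I by exact: measurable_itv.
  have mIp : mu I = pi%:E by rewrite /mu /I lebesgue_measure_itv/= lte_fin p0 sube0.
  by rewrite (integral_cst _ mI) mul1e; exact: mIp.
have mr0 : m%:~R != 0 :> R by rewrite intr_eq0.
have D (t : R) : is_derive t 1 (fun t => sin (t * m%:~R) / m%:~R) (cos (t * m%:~R)).
  have h : is_derive t 1 (fun y : R => y * m%:~R) (m%:~R : R).
    by apply: is_derive_eq; rewrite scaler0 add0r scaler1.
  have h1 := @is_derive1_comp _ sin (fun y : R => y * m%:~R) _ _ _ (is_derive_sin (t * m%:~R)) h.
  have h2 := is_deriveZ (m%:~R : R)^-1 h1.
  rewrite (_ : (fun t => _) = (m%:~R : R)^-1 \*: (sin \o (fun y : R => y * m%:~R))); last first.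
    by apply/funext => y; rewrite /= mulrC.
  by apply: (is_derive_eq h2); rewrite /GRing.scale/=; field.
have C : continuous (fun t : R => cos (t * m%:~R)).
  move=> t; apply: (@continuous_comp _ _ _ (fun t : R => t * m%:~R) cos).
    by apply: cvgM; [exact: cvg_id|exact: cvg_cst].
  exact: continuous_cos.
have CF := derivable_continuous_at _ _ D.
rewrite (@continuous_FTC2 R _ (fun t => sin (t * m%:~R) / m%:~R)) //.
- by rewrite sin_pi_int !mul0r sin0 mul0r sube0.
- exact: continuous_subspaceT.
- split.
  + by move=> t _; have := D t => /@ex_derive.
  + by apply: cvg_at_right_filter; exact: CF.
  + by apply: cvg_at_left_filter; exact: CF.
- by move=> t _; rewrite derive1E; have := D t => /@derive_val.
Qed.

End orthogonality.

Section fourier_inversion.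
Context {R : realType} {d : measure_display} {T : measurableType d}
  {P : probability T R}.
Let mu := @lebesgue_measure R.
Let I : set (measurableTypeR R) := `[0, pi]%classic.
Variable xi : nat -> {RV P >-> R}.
Hypothesis xi_int : forall i w, xi i w \is a Num.int.
Hypothesis xi_iid : iid xi.
Variable g : R.
Let X := xi 0%N.
Hypothesis iX : P.-integrable setT (EFin \o (fun w => expR (g * X w))).
Let phi := moment X 0 g.

Lemma integral_mul_indic (f : R -> R) :
  (\int[mu]_t (f t * \1_I t)%:E = \int[mu]_(t in I) (f t)%:E)%E.
Proof.
rewrite [RHS]integral_mkcond; apply: eq_integral => t _.
by rewrite patchE indicE; case: (t \in I); rewrite ?mulr1 ?mulr0.
Qed.

Lemma walk_int n w : walk xi n w \is a Num.int.
Proof. by rewrite /walk rpred_sum. Qed.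

Lemma tcos_shift c b t x :
  tcos g t (c + b) x = tcos g t c x * cos (t * b) + tsin g t c x * sin (t * b).
Proof.
rewrite /tcos /tsin (_ : t * (x - (c + b)) = t * (x - c) - t * b); last by ring.
by rewrite cosB; ring.
Qed.

Lemma integral_tcos_walk n c k t : phi != 0 ->
  \int[P]_w tcos g t k (walk xi n w) =
  phi ^+ n * phase_part (zcos X g c) (zsin X g c) n (k - n%:R * c) t.
Proof.
move=> phi0; have [iW e] := walk_transform xi g t c n xi_iid iX.
have mW := measurable_walk xi n.
have ic := integrable_tcos (walk xi n) g t (n%:R * c) mW iW.
have isn := integrable_tsin (walk xi n) g t (n%:R * c) mW iW.
have E w : tcos g t k (walk xi n w) =
    cos (t * (k - n%:R * c)) * tcos g t (n%:R * c) (walk xi n w) +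
    sin (t * (k - n%:R * c)) * tsin g t (n%:R * c) (walk xi n w).
  have kE : k = n%:R * c + (k - n%:R * c) by ring.
  by rewrite [in LHS]kE tcos_shift; ring.
under eq_Rintegral => w _ do rewrite E.
rewrite RintegralD//; [|exact: integrable_RZ..].
rewrite !RintegralZl//.
have ec : \int[P]_w tcos g t c (X w) = phi * zcos X g c t by rewrite /zcos mulrC divfK.
have es : \int[P]_w tsin g t c (X w) = phi * zsin X g c t by rewrite /zsin mulrC divfK.
rewrite /X in ec es; rewrite ec es cpowZ in e.
by case: e => -> ->; rewrite /phase_part; ring.
Qed.

(** Integrate [expR (g * S_n) * cos (t * (S_n - k))] over [t] and over the
    probability space.  Integrating first over [t] leaves only the event
    [S_n = k], by orthogonality; integrating first over the probability space
    gives the power of the transform.  Fubini applies as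
    [expR (g * S_n)] is integrable and [[0, pi]] is bounded. *)
Lemma fourier_inversion n (k : int) c : phi != 0 ->
  let F := phase_part (zcos X g c) (zsin X g c) n (k%:~R - n%:R * c) in
  mu.-integrable I (EFin \o F) /\
  phi ^+ n * \int[mu]_(t in I) F t =
  pi * (expR (g * k%:~R) * fine (P (walk xi n @^-1` [set k%:~R]))).
Proof.
move=> phi0 F.
have [iW _] := walk_transform xi g 0 c n xi_iid iX.
have mW := measurable_walk xi n.
have mI : measurable I by exact: measurable_itv.
pose f0 (z : T * measurableTypeR R) : R := tcos g z.2 k%:~R (walk xi n z.1) * \1_I z.2.
pose f : T * measurableTypeR R -> \bar R := EFin \o f0.
pose W := walk xi n.
have mW1 : measurable_fun setT (fun z : T * measurableTypeR R => W z.1).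
  exact: measurableT_comp mW measurable_fst.
have m1 : measurable_fun setT (fun z : T * measurableTypeR R => \1_I z.2 : R).
  by apply: (measurableT_comp _ measurable_snd); exact: measurable_indic.
have me : measurable_fun setT (fun z : T * measurableTypeR R => expR (g * W z.1)).
  exact: measurableT_comp (measurable_expZ g) mW1.
have mf : measurable_fun setT (EFin \o f0).
  apply/measurable_EFinP; apply: measurable_funM; last exact: m1.
  apply: measurable_funM; first exact: me.
  apply: (measurableT_comp (f := cos)).
    by apply: continuous_measurable_fun => x; exact: continuous_cos.
  apply: measurable_funM; first exact: measurable_snd.
  by apply: measurable_funB.
pose G0 (z : T * measurableTypeR R) : R := expR (g * W z.1) * \1_I z.2.
have mG : measurable_fun setT (EFin \o G0).
  by apply/measurable_EFinP; exact: measurable_funM.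
have mIp : mu I = pi%:E.
  by rewrite /mu /I lebesgue_measure_itv/= lte_fin pi_gt0 sube0.
have Gi : (P \x mu)%E.-integrable setT (EFin \o G0).
  apply/integrable12ltyP => //.
  have E w : (\int[mu]_t `|(EFin \o G0) (w, t)| = (expR (g * W w))%:E * pi%:E)%E.
    transitivity (\int[mu]_t ((expR (g * W w))%:E * (\1_I t)%:E))%E.
      apply: eq_integral => t _.
      have h : 0 <= G0 (w, t) by rewrite mulr_ge0 ?expR_ge0// indicE.
      by rewrite gee0_abs ?lee_fin.
    have mi : measurable_fun setT (fun t : measurableTypeR R => (\1_I t)%:E : \bar R).
      by apply/measurable_EFinP; exact: measurable_indic.
    have i0 (t : measurableTypeR R) : setT t -> (0 <= (\1_I t : R)%:E)%E.
      by move=> _; rewrite lee_fin indicE.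
    rewrite (ge0_integralZl_EFin mu measurableT i0 mi (expR_ge0 _)).
    by congr (_ * _)%E; rewrite integral_indic// setIT.
  under eq_integral do rewrite E.
  have -> : (\int[P]_x ((expR (g * W x))%:E * pi%:E) = \int[P]_x (expR (g * W x))%:E * pi%:E)%E.
    exact: (integralZr measurableT iW).
  rewrite muleC; apply: lte_mul_pinfty; rewrite ?lee_fin ?pi_ge0//.
  exact: integrable_lty iW.
have fi : (P \x mu)%E.-integrable setT (EFin \o f0).
  apply: le_integrable mf _ Gi => // z _.
  rewrite /f0 /G0 /= lee_fin !normrM ler_wpM2r//.
  by rewrite -/(W z.1) (le_trans _ (ler_norm _))// -normrM tcos_le.
have FG := Fubini fi.
pose A := walk xi n @^-1` [set k%:~R].
have mA : measurable A by rewrite -[Y in measurable Y]setTI; apply: mW.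
pose HH (t : R) : R := phi ^+ n * F t * \1_I t.
have ER t : (\int[P]_w (EFin \o f0) (w, t) = (HH t)%:E)%E.
  have it := integrable_tcos W g t k%:~R mW iW.
  transitivity (\int[P]_w ((tcos g t k%:~R (W w))%:E * (\1_I t)%:E))%E.
    by apply: eq_integral => w _.
  rewrite (integralZr measurableT it) -[X in (X * _)%E]fineK; last exact: integrable_fin_num.
  by rewrite -/(Rintegral P setT _) (integral_tcos_walk n c).
have EL w : (\int[mu]_t (EFin \o f0) (w, t) = (pi * expR (g * k%:~R) * \1_A w)%:E)%E.
  have [m Wm] : exists m : int, W w = m%:~R by have /intrP[m Wm] := walk_int n w; exists m.
  rewrite (integral_mul_indic (fun t => tcos g t k%:~R (W w))).
  transitivity (\int[mu]_(t in I) ((expR (g * W w))%:E * (cos (t * (m - k)%:~R))%:E))%E.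
    by apply: eq_integral => t _; rewrite -EFinM Wm /tcos intrD rmorphN.
  have ic : mu.-integrable I (EFin \o (fun t : R => cos (t * (m - k)%:~R))).
    apply: integrable_continuous_0pi => t.
    apply: (@continuous_comp _ _ _ (fun t : R => t * (m - k)%:~R) cos).
      by apply: cvgM; [exact: cvg_id|exact: cvg_cst].
    exact: continuous_cos.
  rewrite (integralZl mI ic) integral_cos_int -EFinM subr_eq0; congr EFin.
  rewrite indicE; have [mk|mk] := eqVneq m k.
    have -> : w \in A by apply/mem_set; rewrite /A /preimage /= -mk; exact: Wm.
    by rewrite Wm mk mulr1 mulrC.
  have -> : (w \in A) = false.
    by apply/memNset => Aw; case/eqP: mk; apply: (@intr_inj R); rewrite -Wm; exact: Aw.
  by rewrite !mulr0.
have mHH : measurable_fun setT (EFin \o HH).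
  apply: eq_measurable_fun (measurable_fubini_G fi) => t _; exact: ER.
have EH : (\int[mu]_t (HH t)%:E = \int[mu]_(t in I) (phi ^+ n * F t)%:E)%E.
  exact: (integral_mul_indic (fun t => phi ^+ n * F t)).
have iHI : mu.-integrable I (EFin \o HH).
  pose C := \int[P]_w expR (g * W w).
  apply: (le_integrable mI _ _ (integrable_continuous_0pi (fun=> C) (fun _ => cvg_cst _))).
    exact: measurable_funTS.
  move=> t tI; rewrite /= lee_fin /HH indicE mem_set// mulr1 -(integral_tcos_walk n c)//.
  have it := integrable_tcos W g t k%:~R mW iW.
  apply: (le_trans (le_normr_Rintegral measurableT it)).
  apply: (le_trans _ (ler_norm _)); apply: le_Rintegral => //.
  - by have := integrable_abse it; exact: eq_integrable.
  - by move=> w _; exact: tcos_le.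
have iI : mu.-integrable I (EFin \o F).
  have := integrableZl mI (phi ^- n) iHI; apply: eq_integrable => // t /[!inE] tI.
  rewrite /HH /= indicE mem_set// mulr1 -EFinM mulKf//.
  by rewrite expf_neq0.
split => //.
rewrite -RintegralZl// /Rintegral -EH -(eq_integral _ _ (fun t _ => ER t)) -FG.
under eq_integral do rewrite EL.
rewrite (integralZl measurableT (integrable_indic P mA)) integral_indic// setIT.
by rewrite mulrA fineM// fin_num_measure.
Qed.

End fourier_inversion.

(** * The local limit theorem *)

Section local_limit.
Context {R : realType} {d : measure_display} {T : measurableType d}
  {P : probability T R}.
Variable xi : nat -> {RV P >-> R}.
Hypothesis xi_int : forall i w, xi i w \is a Num.int.
Hypothesis xi_iid : iid xi.
Hypothesis xi_exp : forall g : R, 0 < g ->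
  P.-integrable setT (EFin \o (fun w => expR (g * xi 0%N w))).
Hypothesis xi_span : maximal_span_one (xi 0%N).
Variable g : R.
Hypothesis g0 : 0 < g.
Let X := xi 0%N.
Let phi := moment X 0 g.
Let rho := tmean X g.

Definition walk_mass (n : nat) (k : int) : R := fine (P (walk xi n @^-1` [set k%:~R])).

(** The centring [c = rho] makes the imaginary part of the transform of third
    order; the shift [k - n * rho] is then a mere phase, whose cost is linear
    in the shift. *)
Theorem local_limit : exists2 C : R, 0 <= C & forall (n : nat) (k : int), (0 < n)%N ->
  `|Num.sqrt n%:R * (expR (g * k%:~R) * walk_mass n k / phi ^+ n)
    - (Num.sqrt (2 * pi) * Num.sqrt (tvar X g))^-1|
  <= C * (1 + `|k%:~R - n%:R * rho|) / Num.sqrt n%:R.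
Proof.
have X_int w : X w \is a Num.int by exact: xi_int.
have phi0 : 0 < phi by exact: moment0_gt0.
have [K K0 HK] := transform_taylor X X_int xi_exp g g0.
have [k0 k00 [ks gap]] := transform_gap X X_int xi_exp g g0 xi_span.
have [C C0 HC] := fourier_laplace _ _ k0 (tvar X g) K k00 ks K0 gap HK.
exists C => // n k n0.
have [iF inv] := fourier_inversion xi xi_int xi_iid g (xi_exp g g0) n k rho (lt0r_neq0 phi0).
have := HC n (k%:~R - n%:R * rho) n0 iF.
set J := Rintegral _ _ _ in inv *.
suff -> : expR (g * k%:~R) * walk_mass n k / phi ^+ n = J / pi.
  by rewrite (_ : Num.sqrt n%:R * (J / pi) = Num.sqrt n%:R / pi * J)// mulrAC -mulrA.
have p0 := pi_gt0 R.
have pn0 : 0 < phi ^+ n by rewrite exprn_gt0.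
move: inv pn0; move: (phi ^+ n) (pi : R) p0 => q p p0 inv q0.
apply: (mulfI (lt0r_neq0 (mulr_gt0 p0 q0))).
transitivity (p * (expR (g * k%:~R) * walk_mass n k)); first by field; rewrite gt_eqF.
by rewrite -inv; field; rewrite gt_eqF.
Qed.

End local_limit.

(** * Series and elementary growth bounds *)
Section series_bounds.
Context {R : realType}.

Lemma geometric_sum (q : R) n : q != 1 ->
  \sum_(j < n) q ^+ j = (1 - q ^+ n) / (1 - q).
Proof.
move=> q1; have q1' : 1 - q != 0 by rewrite subr_eq0 eq_sym.
elim: n => [|n IH]; first by rewrite big_ord0 expr0 subrr mul0r.
by rewrite big_ord_recr /= IH (exprS q); field.
Qed.

(** These are the partial sums of [(1 - q) ^- 2]. *)
Lemma arith_geometric_sum (q : R) n : 0 <= q -> q < 1 ->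
  \sum_(j < n) j.+1%:R * q ^+ j <= (1 - q) ^- 2.
Proof.
move=> q0 q1; have q2 : 0 < (1 - q) ^+ 2 by rewrite exprn_gt0// subr_gt0.
rewrite -[leRHS]mul1r ler_pdivlMr//.
have -> : (\sum_(j < n) j.+1%:R * q ^+ j) * (1 - q) ^+ 2 =
    1 - q ^+ n - n%:R * q ^+ n * (1 - q).
  elim: n => [|n IH]; first by rewrite big_ord0 expr0; ring.
  by rewrite big_ord_recr /= mulrDl IH (exprS q) -(natr1 n); ring.
have qn : 0 <= q ^+ n by rewrite exprn_ge0.
have : 0 <= n%:R * q ^+ n * (1 - q) by rewrite !mulr_ge0 ?ler0n// subr_ge0 ltW.
lra.
Qed.

(** The shift [k - n * rho] at the critical level has size [ln n]; bounding it
    by [n ^ (1/4)] against the rate [n ^ (-1/2)] leaves an error of the simple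
    form [n ^ (-1/4)]. *)
Lemma ln_le_fourth_root (n : nat) : (0 < n)%N -> ln (n%:R : R) <= 4 * Num.sqrt (Num.sqrt n%:R).
Proof.
move=> n0; have N0 : 0 < n%:R :> R by rewrite ltr0n.
set s := Num.sqrt (Num.sqrt _).
have s0 : 0 < s by rewrite !sqrtr_gt0.
have E : n%:R = s ^+ 4 :> R.
  by rewrite (exprM s 2 2) sqr_sqrtr ?sqrtr_ge0// sqr_sqrtr// ltW.
rewrite E lnXn// -(mulr_natl (ln s)) ler_wpM2l//; exact/ltW/ln_sublinear.
Qed.

Lemma expRN_le_inv (x : R) : 0 < x -> expR (- x) <= x^-1.
Proof.
move=> x0; rewrite expRN lef_pV2 ?posrE ?expR_gt0//.
by apply: le_trans (expR_ge1Dx x); rewrite lerDr.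
Qed.

End series_bounds.

(** * Tail asymptotics at the critical level *)
Section tails.
Context {R : realType} {d : measure_display} {T : measurableType d}
  {P : probability T R}.
Variable xi : nat -> {RV P >-> R}.
Hypothesis xi_int : forall i w, xi i w \is a Num.int.
Hypothesis xi_iid : iid xi.
Hypothesis xi_exp : forall g : R, 0 < g ->
  P.-integrable setT (EFin \o (fun w => expR (g * xi 0%N w))).

Definition walk_tail (n : nat) (x : R) : R := fine (P [set w | x <= walk xi n w]).

Lemma measurable_walk_ge n x : measurable [set w | x <= walk xi n w].
Proof.
rewrite (_ : [set w | _] = walk xi n @^-1` `[x, +oo[%classic); last first.
  by apply/seteqP; split => w /=; rewrite in_itv/= andbT.
rewrite -[Y in measurable Y]setTI; apply: (measurable_walk xi n) => //.
Qed.

Lemma walk_tail_ge0 n x : 0 <= walk_tail n x.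
Proof. by rewrite fine_ge0. Qed.

Lemma walk_tail_step n (k : int) :
  walk_tail n k%:~R = walk_mass xi n k + walk_tail n (k + 1)%:~R.
Proof.
have mA : measurable (walk xi n @^-1` [set k%:~R]).
  by rewrite -[Y in measurable Y]setTI; apply: (measurable_walk xi n).
have mB := measurable_walk_ge n (k + 1)%:~R.
rewrite /walk_mass /walk_tail -fineD; [|exact: fin_num_measure..].
rewrite -measureU//.
  congr (fine (P _)); apply/seteqP; split => w /=.
    have /intrP[m ->] := walk_int xi xi_int n w.
    by rewrite !ler_int lezD1 le_eqVlt => /orP[/eqP ->|]; [left|right].
  have /intrP[m ->] := walk_int xi xi_int n w.
  by rewrite !ler_int lezD1 => -[/intr_inj ->//|]; exact: ltW.
apply/seteqP; split => w //= [->]; rewrite ler_int; lia.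
Qed.

(** Splitting off finitely many terms keeps the sum finite; the remaining tail
    is left to the Chernoff bound. *)
Lemma walk_tail_sum n (k : int) N : walk_tail n k%:~R =
  \sum_(j < N) walk_mass xi n (k + j%:Z) + walk_tail n (k + N%:Z)%:~R.
Proof.
elim: N => [|N IH]; first by rewrite big_ord0 add0r addr0.
rewrite big_ord_recr /= IH walk_tail_step addrA; congr (_ + walk_tail _ _%:~R).
by rewrite -addrA intS [1 + _]addrC.
Qed.

Lemma walk_tail_chernoff n g x : 0 < g ->
  walk_tail n x <= moment (xi 0%N) 0 g ^+ n * expR (- (g * x)).
Proof.
move=> g0; have mW := measurable_walk xi n.
pose W : {RV P >-> R} := HB.pack (walk xi n) (isMeasurableFun.Build _ _ _ _ _ mW).
have := chernoff W x g0.
have -> : ('M_P W g = (moment (xi 0%N) 0 g ^+ n)%:E)%E.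
  rewrite moment0E -(integral_exp_walk xi g n xi_iid (xi_exp g g0)) fineK.
    rewrite /mmt_gen_fun unlock; apply: eq_integral => w _.
    by rewrite /= mulrC.
  have [iW _] := walk_transform xi g 0 0 n xi_iid (xi_exp g g0).
  exact: integrable_fin_num iW.
rewrite -EFinM -lee_fin; apply: le_trans.
by rewrite fineK// fin_num_measure//; exact: measurable_walk_ge.
Qed.

Hypothesis xi_span : maximal_span_one (xi 0%N).
Variable g : R.
Hypothesis g0 : 0 < g.
Let phi := moment (xi 0%N) 0 g.
Let rho := tmean (xi 0%N) g.
Let q := expR (- g).
Hypothesis critical : 2 * phi = expR (g * rho).

Let q0 : 0 < q. Proof. exact: expR_gt0. Qed.
Let q1 : q < 1. Proof. by rewrite expR_lt1 oppr_lt0. Qed.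

Let kappa := (Num.sqrt (2 * pi) * Num.sqrt (tvar (xi 0%N) g))^-1.

(** Criticality cancels the exponentials in [n], and the logarithmic shift of
    the level leaves [expR (ln n / 2)]. *)
Lemma critical_scaling n (x z : R) : (0 < n)%N ->
  x = n%:R * rho - ln n%:R / (2 * g) + z ->
  2 ^+ n * expR (g * z) * phi ^+ n * expR (- (g * x)) = Num.sqrt n%:R.
Proof.
move=> n0 ->; have N0 : 0 < n%:R :> R by rewrite ltr0n.
have -> : Num.sqrt n%:R = expR (ln n%:R / 2) :> R.
  apply: (@pexpIrn _ 2%N) => //; rewrite ?nnegrE ?sqrtr_ge0 ?expR_ge0//.
  rewrite sqr_sqrtr ?ltW// -expRM_natl -[in LHS](lnK (x := n%:R)) ?posrE//.
  by congr expR; field.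
rewrite -[_ * phi ^+ n]mulrAC -exprMn critical -expRM_natl -!expRD; congr expR.
by field; rewrite gt_eqF.
Qed.

Lemma expR_pow_q j : q ^+ j = expR (- (g * j%:R)).
Proof. by rewrite /q -expRM_natl; congr expR; ring. Qed.

(** With [E j = sqrt n * q_n (x + j)], where [q_n] is the tilted law of [S_n],
    the quantity is the sum over [j < n] of [q ^+ j * E j], plus a Chernoff
    tail.  Replacing [E j] by its limit [kappa] costs, by the local limit
    theorem, a multiple of the sum of [(j + 1) * q ^+ j], which converges. *)
Lemma tail_asymptotics (Z : R) : 0 <= Z -> exists2 M : R, 0 <= M &
  forall (n : nat) (z : R) (x : int), (0 < n)%N -> `|z| <= Z ->
  x%:~R = n%:R * rho - ln n%:R / (2 * g) + z ->
  `|2 ^+ n * expR (g * z) * walk_tail n x%:~R - kappa / (1 - q)| <=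
  M / Num.sqrt (Num.sqrt n%:R).
Proof.
move=> Z0.
have phi0 : 0 < phi by apply: moment0_gt0 => //; exact: xi_int.
have [C C0 HC] := local_limit xi xi_int xi_iid xi_exp xi_span g g0.
pose D := (1 - q) ^- 2.
have q1' : 0 < 1 - q by rewrite subr_gt0.
have D0 : 0 <= D by rewrite invr_ge0 exprn_ge0// ltW.
have kappa0 : 0 <= kappa by rewrite invr_ge0 mulr_ge0 ?sqrtr_ge0.
have gi0 : 0 <= g^-1 by rewrite invr_ge0 ltW.
(* The three terms bound the local limit error, the truncation of the
   geometric series at [n], and the tail beyond [x + n]. *)
exists (C * D * (1 + Z + 2 / g) + kappa / (1 - q) / g + g^-1).
  have h2 : 0 <= 2 / g by rewrite mulr_ge0.
  have h1 : 0 <= C * D * (1 + Z + 2 / g) by rewrite mulr_ge0 ?mulr_ge0//; lra.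
  have h3 : 0 <= kappa / (1 - q) / g by rewrite mulr_ge0// divr_ge0// ltW.
  lra.
move=> n z x n0 zZ xE.
have N0 : 0 < n%:R :> R by rewrite ltr0n.
have N1 : 1 <= n%:R :> R by rewrite ler1n.
set s := Num.sqrt (Num.sqrt _).
have s1 : 1 <= s by rewrite /s -{1}(sqrtr1 R) -{1}(sqrtr1 R) !ler_wsqrtr.
have s0 : 0 < s by lra.
have ss : Num.sqrt n%:R = s * s by rewrite -expr2 sqr_sqrtr// sqrtr_ge0.
have nn : n%:R = s * s * (s * s) by rewrite -ss -expr2 sqr_sqrtr// ltW.
pose S : R := 2 ^+ n * expR (g * z).
have S0 : 0 <= S by rewrite mulr_ge0 ?exprn_ge0 ?expR_ge0.
have scal : S * phi ^+ n * expR (- (g * x%:~R)) = s * s.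
  by rewrite -ss; exact: critical_scaling.
pose b := `|x%:~R - n%:R * rho|.
have b0 : 0 <= b by exact: normr_ge0.
have bs : b <= Z + 2 / g * s.
  rewrite /b xE (_ : _ - _ = z - ln n%:R / (2 * g)); last by ring.
  apply: (le_trans (ler_normB _ _)); apply: lerD => //.
  have l0 : 0 <= ln (n%:R : R) by rewrite ln_ge0.
  rewrite ger0_norm; last by rewrite divr_ge0// mulr_ge0// ltW.
  have := ln_le_fourth_root (R := R) n n0; rewrite -/s => l4.
  rewrite ler_pdivrMr ?mulr_gt0//.
  by rewrite (_ : 2 / g * s * (2 * g) = 4 * s)//; field; rewrite gt_eqF.
have bs1 : (1 + b) / (s * s) <= (1 + Z + 2 / g) / s.
  rewrite invfM mulrA ler_wpM2r ?invr_ge0 ?(ltW s0)// ler_pdivrMr//.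
  have : Z <= Z * s by rewrite ler_peMr.
  have : 0 <= 2 / g by rewrite mulr_ge0.
  lra.
pose E (j : nat) : R := s * s * (expR (g * (x + j%:Z)%:~R) * walk_mass xi n (x + j%:Z) / phi ^+ n).
have EE j : S * walk_mass xi n (x + j%:Z) = q ^+ j * E j.
  have -> : q ^+ j * E j = s * s * (q ^+ j * expR (g * (x + j%:Z)%:~R)) * walk_mass xi n (x + j%:Z) / phi ^+ n.
    by rewrite /E; ring.
  have -> : q ^+ j * expR (g * (x + j%:Z)%:~R) = expR (g * x%:~R).
    by rewrite expR_pow_q -expRD; congr expR; rewrite intrD; ring.
  rewrite -scal expRN; move: (exprn_gt0 n phi0) (expR_gt0 (g * x%:~R)).
  move: (phi ^+ n) (expR (g * x%:~R)) => f e f0 e0.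
  by field; rewrite !gt_eqF.
have Ebound j : `|E j - kappa| <= C * ((1 + b) * j.+1%:R) / (s * s).
  have := HC n (x + j%:Z) n0; rewrite ss => /le_trans; apply.
  rewrite ler_wpM2r ?invr_ge0 ?mulr_ge0 ?(ltW s0)// ler_wpM2l//.
  have : `|(x + j%:Z)%:~R - n%:R * rho| <= b + j%:R.
    rewrite (_ : _ - _ = (x%:~R - n%:R * rho) + j%:R); last by rewrite intrD; ring.
    by apply: (le_trans (ler_normD _ _)); rewrite lerD2l normr_nat.
  have : 0 <= b * j%:R by rewrite mulr_ge0.
  by rewrite -natr1; lra.
rewrite -/S (walk_tail_sum n x n) mulrDr mulr_sumr.
under eq_bigr => j _ do rewrite EE.
have -> : \sum_(j < n) q ^+ j * E j =
    \sum_(j < n) q ^+ j * (E j - kappa) + kappa * ((1 - q ^+ n) / (1 - q)).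
  rewrite -geometric_sum ?lt_eqF// mulr_sumr -big_split/=.
  by apply: eq_bigr => j _; ring.
set A := \sum_(j < n) _.
have hA : `|A| <= C * D * (1 + Z + 2 / g) / s.
  apply: (@le_trans _ _ (\sum_(j < n) C * ((1 + b) / (s * s)) * (j.+1%:R * q ^+ j))).
    apply: (le_trans (ler_norm_sum _ _ _)); apply: ler_sum => j _.
    rewrite normrM ger0_norm ?exprn_ge0 ?(ltW q0)//.
    have := ler_wpM2l (exprn_ge0 j (ltW q0)) (Ebound j); move/le_trans; apply.
    by rewrite le_eqVlt; apply/orP; left; apply/eqP; field; rewrite gt_eqF.
  rewrite -mulr_sumr.
  have c0 : 0 <= C * ((1 + b) / (s * s)).
    by rewrite mulr_ge0// divr_ge0 ?addr_ge0// mulr_ge0// ltW.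
  apply: (le_trans (ler_wpM2l c0 (arith_geometric_sum q n (ltW q0) q1))).
  rewrite -/D [leLHS]mulrAC -[leRHS]mulrA.
  by rewrite ler_wpM2l// mulr_ge0.
have qn : q ^+ n <= g^-1 / (s * s * (s * s)).
  rewrite expR_pow_q nn -invfM; apply: expRN_le_inv.
  by rewrite !mulr_gt0.
have s2 : (s * s)^-1 <= s^-1.
  by rewrite lef_pV2 ?posrE ?mulr_gt0// ler_peMr// ltW.
have s4 : (s * s * (s * s))^-1 <= s^-1.
  rewrite lef_pV2 ?posrE ?mulr_gt0//; have ss1 : 1 <= s * s by rewrite mulr_ege1.
  have ss0 : 0 <= s * s by lra.
  have h1 : s <= s * s by rewrite ler_peMr ?(ltW s0).
  by apply: (le_trans h1); rewrite ler_peMr.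
have hq : `|kappa * ((1 - q ^+ n) / (1 - q)) - kappa / (1 - q)| <= kappa / (1 - q) / g / s.
  rewrite (_ : _ - _ = - (kappa / (1 - q) * q ^+ n)); last by field; rewrite gt_eqF.
  have kq : 0 <= kappa / (1 - q) by rewrite divr_ge0// ltW.
  rewrite normrN ger0_norm; last by rewrite mulr_ge0// exprn_ge0// ltW.
  rewrite -[leRHS]mulrA -[leRHS]mulrA mulrA ler_wpM2l//.
  by apply: (le_trans qn); rewrite ler_wpM2l.
pose r := S * walk_tail n (x + n%:Z)%:~R.
have hr : `|r| <= g^-1 / s.
  rewrite ger0_norm; last by rewrite mulr_ge0 ?walk_tail_ge0.
  apply: (le_trans (ler_wpM2l S0 (walk_tail_chernoff n g _ g0))).
  have -> : S * (moment (xi 0%N) 0 g ^+ n * expR (- (g * (x + n%:Z)%:~R))) = s * s * q ^+ n.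
    rewrite -scal expR_pow_q -/phi -[RHS]mulrA -expRD mulrA; congr (_ * expR _).
    by rewrite intrD; ring.
  have ss0 : 0 <= s * s by rewrite mulr_ge0// ltW.
  apply: (le_trans (ler_wpM2l ss0 qn)).
  have -> : s * s * (g^-1 / (s * s * (s * s))) = g^-1 / (s * s) by field; rewrite !gt_eqF.
  by rewrite ler_wpM2l.
rewrite -/r.
have -> : A + kappa * ((1 - q ^+ n) / (1 - q)) + r - kappa / (1 - q) =
  A + (kappa * ((1 - q ^+ n) / (1 - q)) - kappa / (1 - q)) + r by ring.
apply: (le_trans (ler_normD _ _)); rewrite [leRHS]mulrDl; apply: lerD => //.
by apply: (le_trans (ler_normD _ _)); rewrite [leRHS]mulrDl; apply: lerD.
Qed.

End tails.

(** * The maximum of independent copies *)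
Section extremes.
Context {R : realType} {d : measure_display} {T : measurableType d}
  {P : probability T R}.

(** The maximum is below [y] iff all the copies are. *)
Lemma max_copies_lt (Y : T -> R) (S : forall n : nat, 'I_(2 ^ n) -> {RV P >-> R})
  (n : nat) (y : R) : measurable_fun setT Y -> independent_copies Y (S n) ->
  P [set w | (max_copies S n w < y%:E)%E] =
  ((1 - fine (P [set w | y <= Y w])) ^+ (2 ^ n))%:E.
Proof.
move=> mY [ind law].
pose J : {fset 'I_(2 ^ n)} := [fset i in enum 'I_(2 ^ n)]%fset.
have inJ i : i \in J by rewrite inE mem_enum.
pose B : set R := `]-oo, y[%classic.
have mB : measurable B by exact: measurable_itv.
have -> : [set w | (max_copies S n w < y%:E)%E] = \bigcap_(i in [set` J]) (S n i @^-1` B).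
  apply/seteqP; split => w /=; rewrite /max_copies.
    by move=> /bigmax_ltP[_ H] i _; rewrite /B /= in_itv/= -lte_fin; exact: H.
  move=> H; apply/bigmax_ltP; split; first exact: ltNyr.
  by move=> i _; have := H i (inJ i); rewrite /B /= in_itv/= lte_fin.
rewrite (ind J (fun=> B)) //.
have PB : P (Y @^-1` B) = (1 - fine (P [set w | y <= Y w]))%:E.
  have mC : measurable [set w | y <= Y w].
    rewrite (_ : [set w | _] = Y @^-1` `[y, +oo[%classic); last first.
      by apply/seteqP; split => w /=; rewrite in_itv/= andbT.
    by rewrite -[X in measurable X]setTI; apply: mY => //; exact: measurable_itv.
  rewrite (_ : Y @^-1` B = ~` [set w | y <= Y w]); last first.
    apply/seteqP; split => w /=; rewrite /B/= in_itv/= ltNge; first by move/negP.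
    by move=> H; apply/negP.
  by rewrite probability_setC// EFinB fineK// fin_num_measure.
under eq_bigr => i _ do rewrite (law i B mB) PB.
rewrite prodEFin (perm_big (enum 'I_(2 ^ n))); last first.
  by apply: uniq_perm; rewrite ?fset_uniq ?enum_uniq// => i; rewrite inJ mem_enum.
by rewrite big_enum prodr_const card_ord.
Qed.

Lemma neg_ln_one_sub (p : R) : 0 <= p -> p <= 2^-1 ->
  p <= - ln (1 - p) /\ - ln (1 - p) <= p + 2 * p ^+ 2.
Proof.
move=> p0 p1; have q0 : 0 < 1 - p by lra.
split.
  have := @le_ln1Dx R (- p); rewrite lerNr; apply; lra.
have : - ln (1 - p) <= (1 - p)^-1 - 1.
  rewrite -lnV ?posrE// -{1}(subrK 1 (1 - p)^-1) addrC; apply: le_ln1Dx.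
  have : 0 < (1 - p)^-1 by rewrite invr_gt0.
  lra.
move/le_trans; apply; rewrite lerBlDr -[leLHS]mul1r ler_pdivrMr//.
have : 0 <= p ^+ 2 * (1 - 2 * p) by rewrite mulr_ge0 ?sqr_ge0//; lra.
lra.
Qed.

(** Replacing [p] by [- ln (1 - p)] changes [N * E * p] by a relative amount
    [2 * p]. *)
Lemma scaled_ln_near (N E p c e : R) : 0 < N -> 0 < E -> 0 <= p -> p <= 2^-1 ->
  `|N * E * p - c| <= e ->
  `|N * E * - ln (1 - p) - c| <= e + 2 * p * (c + e).
Proof.
move=> N0 E0 p0 p1; have [l1 l2] := neg_ln_one_sub p p0 p1.
have NE : 0 <= N * E by rewrite mulr_ge0 ?ltW.
have h1 := ler_wpM2l NE l1; have h2 := ler_wpM2l NE l2.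
rewrite ler_norml => /andP[h3 h4].
have h5 : 2 * p * (N * E * p) <= 2 * p * (c + e) by rewrite ler_wpM2l ?mulr_ge0//; lra.
have h6 : 0 <= 2 * p * (N * E * p) by rewrite !mulr_ge0 ?(ltW N0) ?(ltW E0).
have E2 : N * E * (p + 2 * p ^+ 2) = N * E * p + 2 * p * (N * E * p) by ring.
rewrite E2 in h2; rewrite ler_norml; move: h1 h2 h3 h4 h5 h6.
move: (N * E * - ln (1 - p)) (N * E * p) => u v; move: (2 * p * v) (2 * p * (c + e)) => a b *.
by apply/andP; split; lra.
Qed.

Lemma fourth_root_infty (A : R) : \forall n \near \oo, A < Num.sqrt (Num.sqrt (n%:R : R)).
Proof.
near=> n; rewrite ltNge; apply/negP => sA.
have A0 : 0 <= A by apply: le_trans sA; rewrite sqrtr_ge0.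
have : A ^+ 4 < n%:R by near: n; exact: nbhs_infty_gtr.
apply/negP; rewrite -leNgt.
have -> : (n%:R : R) = Num.sqrt (Num.sqrt n%:R) ^+ 4.
  by rewrite (exprM _ 2 2) sqr_sqrtr ?sqrtr_ge0// sqr_sqrtr.
by rewrite lerXn2r ?nnegrE ?sqrtr_ge0.
Unshelve. all: by end_near. Qed.

End extremes.

Theorem theorem2 (R : realType) (d : measure_display) (T : measurableType d)
  (P : probability T R)
  (xi : nat -> {RV P >-> R})
  (S : forall n : nat, 'I_(2 ^ n) -> {RV P >-> R})
  (xi_int : forall (i : nat) (w : T), xi i w \is a Num.int)
  (xi_iid : iid xi)
  (xi_span : maximal_span_one (xi 0%N))
  (xi_mean : ('E_P[fun w => `|xi 0%N w|%R] < +oo)%E)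
  (xi_exp : forall gamma : R, 0 < gamma -> ('M_P (xi 0%N) gamma < +oo)%E)
  (xi_upper : upper_bound (xi 0%N) = +oo%E \/
    ((upper_bound (xi 0%N) < +oo)%E /\
     (P [set w | (xi 0%N w)%:E = upper_bound (xi 0%N)] < (2^-1)%:E)%E))
  (S_copies : forall n : nat, independent_copies (walk xi n) (S n))
  (I : set R) (I_itv : is_interval I) (I_bnd : bounded_set I) :
  let gs := gamma_star (xi 0%N) in
  exists o1 : nat -> R -> R,
    (forall e : R, 0 < e -> \forall n \near \oo, forall z : R,
       I z -> level (xi 0%N) n z \is a Num.int -> `|o1 n z| < e) /\
    (\forall n \near \oo, forall z : R,
       I z -> level (xi 0%N) n z \is a Num.int ->
       P [set w | (max_copies S n w < (level (xi 0%N) n z)%:E)%E] =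
       (expR (- (expR (- gs * z) * (1 + o1 n z) /
                 (Num.sqrt (2 * pi) * sigma (xi 0%N) gs *
                  (1 - expR (- gs))))))%:E).
Proof.
move=> gs; set X := xi 0%N in xi_span xi_mean xi_exp xi_upper gs *.
have X_int w : X w \is a Num.int by exact: xi_int.
have Xexp g : 0 < g -> P.-integrable setT (EFin \o (fun w => expR (g * X w))).
  move=> g0; apply/integrableP; split.
    by apply/measurable_EFinP; apply: measurableT_comp (measurable_expZ g) _.
  apply: le_lt_trans (xi_exp g g0); rewrite /mmt_gen_fun unlock.
  rewrite le_eqVlt; apply/orP; left; apply/eqP; apply: eq_integral => w _.
  by rewrite /= ger0_norm ?expR_ge0// mulrC.
have Xabs : P.-integrable setT (EFin \o (fun w => `|X w|)).
  apply/integrableP; split; first by apply/measurable_EFinP; apply: measurableT_comp.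
  move: xi_mean; rewrite unlock; apply: le_lt_trans.
  rewrite le_eqVlt; apply/orP; left; apply/eqP; apply: eq_integral => w _.
  by rewrite /= normr_id.
have [gs0 gsE] := gamma_star_spec X X_int Xexp Xabs xi_upper.
rewrite -/gs in gs0 gsE.
have phi0 := moment0_gt0 X X_int Xexp gs gs0.
have rhoE : rho_star X = tmean X gs by rewrite /rho_star derive1_cumulant.
have sigmaE : sigma X gs = Num.sqrt (tvar X gs) by rewrite /sigma derive2_cumulant.
have critical : 2 * moment X 0 gs = expR (gs * tmean X gs).
  rewrite derive1_cumulant// cumulantE /= lnV ?posrE// in gsE.
  rewrite -[LHS]lnK ?posrE ?mulr_gt0// lnM ?posrE//; congr expR.
  by rewrite /tmean; lra.
have [Z Z0 IZ] : exists2 Z : R, 0 <= Z & forall z, I z -> `|z| <= Z.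
  have [M [_ HM]] := I_bnd; exists (`|M| + 1); first by rewrite addr_ge0.
  by move=> z Iz; apply: HM => //; have := ler_norm M; lra.
have [M M0 HM] := tail_asymptotics xi xi_int xi_iid Xexp xi_span gs gs0 critical Z Z0.
set kappa := (Num.sqrt _ * Num.sqrt _)^-1 in HM; set q := expR (- gs) in HM *.
have [k0 k00 [ks _]] := transform_gap X X_int Xexp gs gs0 xi_span.
have kappa0 : 0 < kappa.
  by rewrite invr_gt0 mulr_gt0// sqrtr_gt0 ?mulr_gt0 ?pi_gt0//; lra.
have q1 : 0 < 1 - q by rewrite subr_gt0 expR_lt1 oppr_lt0.
pose c0 := kappa / (1 - q).
have c00 : 0 < c0 by rewrite divr_gt0.
have c0E x : x / (Num.sqrt (2 * pi) * sigma X gs * (1 - q)) = x * c0.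
  by rewrite sigmaE /c0; congr (x * _); rewrite invfM.
pose p n z := walk_tail xi n (level X n z).
(* The error term is read off from the exact value of the probability, so that
   the identity holds by construction and only its smallness is at stake. *)
pose o1 (n : nat) (z : R) : R := 2 ^+ n * expR (gs * z) * - ln (1 - p n z) / c0 - 1.
pose s n : R := Num.sqrt (Num.sqrt n%:R).
(* [K / s n] bounds [p n z]: the scaled tail is at most [c0 + M], and
   [s n <= 2 ^+ n]. *)
pose K := (c0 + M) * expR (gs * Z).
have K0 : 0 < K by rewrite mulr_gt0 ?expR_gt0// ltr_wpDr.
have bounds n z : (0 < n)%N -> 1 <= s n -> K / s n <= 2^-1 -> I z ->
    level X n z \is a Num.int ->
    0 <= p n z <= 2^-1 /\ `|o1 n z| <= (M + 2 * K * (c0 + M)) / c0 / s n.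
  move=> n0 s1 sK Iz /intrP[x lx].
  have s0 : 0 < s n by lra.
  have zZ := IZ z Iz.
  have lE : x%:~R = n%:R * tmean X gs - ln n%:R / (2 * gs) + z.
    by rewrite -lx /level rhoE -/gs [tmean X gs * _]mulrC.
  have H := HM n z x n0 zZ lE; rewrite -lx -/(p n z) -/(s n) -/c0 in H.
  have p0 : 0 <= p n z by exact: walk_tail_ge0.
  have Ms : M / s n <= M by rewrite ler_pdivrMr// ler_peMr.
  have s2n : s n <= 2 ^+ n.
    apply: (@le_trans _ _ n%:R).
      have N1 : 1 <= n%:R :> R by rewrite ler1n.
      have h1 : Num.sqrt n%:R <= n%:R :> R.
        rewrite -[leRHS]sqr_sqrtr ?ler0n// expr2 ler_peMr ?sqrtr_ge0//.
        by rewrite -{1}(sqrtr1 R) ler_wsqrtr.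
      apply: le_trans h1; rewrite /s -[leRHS]sqr_sqrtr ?sqrtr_ge0// expr2 ler_peMr ?sqrtr_ge0//.
    by rewrite -natrX ler_nat ltnW// ltn_expl.
  have pK : p n z <= K / s n.
    rewrite ler_pdivlMr// mulrC; apply: (@le_trans _ _ (2 ^+ n * p n z)).
      by rewrite ler_wpM2r.
    have -> : 2 ^+ n * p n z = 2 ^+ n * expR (gs * z) * p n z * expR (- (gs * z)).
      by rewrite expRN; field; rewrite gt_eqF ?expR_gt0.
    apply: ler_pM; rewrite ?expR_ge0//.
    - by rewrite !mulr_ge0 ?exprn_ge0 ?expR_ge0.
    - by move: H; rewrite ler_norml => /andP[_]; lra.
    - rewrite ler_expR -mulrN ler_pM2l//; apply: le_trans zZ.
      by rewrite -normrN ler_norm.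
  have ph := le_trans pK sK.
  split; first by rewrite p0 ph.
  have := scaled_ln_near (2 ^+ n) (expR (gs * z)) (p n z) c0 (M / s n) _ (expR_gt0 _) p0 ph H.
  rewrite exprn_gt0// => /(_ isT) H2.
  have -> : o1 n z = (2 ^+ n * expR (gs * z) * - ln (1 - p n z) - c0) / c0.
    by rewrite /o1 mulrBl divff// gt_eqF.
  rewrite normrM (ger0_norm (x := c0^-1)) ?invr_ge0 ?(ltW c00)//.
  have -> : (M + 2 * K * (c0 + M)) / c0 / s n = (M / s n + 2 * (K / s n) * (c0 + M)) / c0.
    by field; rewrite !gt_eqF.
  rewrite ler_wpM2r ?invr_ge0 ?(ltW c00)//; apply: (le_trans H2).
  rewrite lerD2l; apply: ler_pM; rewrite ?mulr_ge0//.
  - by rewrite addr_ge0 ?(ltW c00)// divr_ge0// ltW.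
  - by rewrite ler_wpM2l.
  - by rewrite lerD2l.
have large A : \forall n \near \oo, A < s n by exact: fourth_root_infty.
have sK2 n : 2 * K < s n -> 1 < s n -> K / s n <= 2^-1.
  move=> h1 h2; rewrite ler_pdivrMr; last by lra.
  lra.
exists o1; split.
  move=> e e0; near=> n => z Iz lz.
  have n0 : (0 < n)%N by near: n; exact: nbhs_infty_gt.
  have s1 : 1 < s n by near: n; exact: large.
  have s2 : 2 * K < s n by near: n; exact: large.
  have s3 : (M + 2 * K * (c0 + M)) / c0 / e < s n by near: n; exact: large.
  have [_ H] := bounds n z n0 (ltW s1) (sK2 n s2 s1) Iz lz.
  apply: (le_lt_trans H); rewrite ltr_pdivrMr; last by lra.
  by rewrite [e * _]mulrC -ltr_pdivrMr.
near=> n => z Iz lz.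
have n0 : (0 < n)%N by near: n; exact: nbhs_infty_gt.
have s1 : 1 < s n by near: n; exact: large.
have s2 : 2 * K < s n by near: n; exact: large.
have [/andP[p0 p1] _] := bounds n z n0 (ltW s1) (sK2 n s2 s1) Iz lz.
rewrite (max_copies_lt (walk xi n) S n _ (measurable_walk xi n) (S_copies n)).
congr EFin; rewrite c0E -/(walk_tail xi n (level X n z)) -/(p n z).
have q0 : 0 < 1 - p n z by lra.
rewrite -[1 - p n z]lnK ?posrE// -expRM_natl; congr expR.
have -> : 1 + o1 n z = 2 ^+ n * expR (gs * z) * - ln (1 - p n z) / c0.
  by rewrite /o1 addrC subrK.
rewrite mulNr expRN natrX; move: (expR_gt0 (gs * z)).
move: (expR (gs * z)) (ln (1 - p n z)) => E l E0.
by field; rewrite !gt_eqF.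
Unshelve. all: by end_near. Qed.
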